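(* The single-product problem of minimizing delivery and storage costs under restrictions on delivery volumes, $$\sum_{i=1}^n k_i(x_i)+\sum_{i=1}^n\frac{c\,x_i^2}{2\lambda}\to\min,\qquad \sum_{i=1}^n x_i\ge P,\qquad x_i\in\{0\}\cup[m_i,M_i]\quad (i=1,\dots,n),$$ over real vectors $(x_1,\dots,x_n)$, with integer input data $n,P,\lambda,c,\alpha_i,\beta_i,m_i,M_i$ (where $n\ge1$, $P,\lambda,c>0$, $\alpha_i,\beta_i\ge 0$, $0\le m_i\le M_i$), is pseudopolynomially solvable: there is an algorithm that solves it using $$O\Bigl(P\,n^3\,c^2\sum_{k=1}^n (M_k-m_k)\Bigr)$$ operations.
   Context: There are $n$ suppliers with at most one delivery from each. $P$ is the total demand, $\lambda$ is the consumption intensity, $c$ (written $c_{xp}$ in the source) is the unit storage cost, $m_i$ and $M_i$ are the minimal and maximal delivery volumes of supplier $i$, and $x_i$ is the volume delivered by supplier $i$. The delivery cost function of supplier $i$ is $$k_i(v)=\begin{cases}0,& v=0,\\ \alpha_i+\beta_i v,& v>0.\end{cases}$$ Operations are elementary arithmetic operations and comparisons on numbers. Solving the problem means finding an optimal solution and the optimal value. An algorithm is pseudopolynomial if its running time is bounded by a polynomial in the number of input parameters and their numerical values.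
   Formalization: In the operation bound the sum of (M_k - m_k) is replaced by max(1, sum of (M_k - m_k)), since when all M_k = m_k the stated bound would be 0 operations, which no algorithm can meet; otherwise the bound is unchanged. *)

(* Defs.v *)
(* MathComp, with the real numbers as an arbitrary [R : realType]. *)
From HB Require Import structures.
From mathcomp Require Import all_boot all_order all_algebra.
From mathcomp Require Import reals.

Set Implicit Arguments.
Unset Strict Implicit.
Unset Printing Implicit Defensive.

Import Order.TTheory GRing.Theory Num.Theory.
Local Open Scope ring_scope.

(** * The delivery problem *)

(* All input data are integers, and nonnegative, hence of type [nat]. *)
Record problem := Problem {
  suppliers    : nat;                       (* n *)
  demand       : nat;                       (* P *)
  intensity    : nat;                       (* lambda *)
  storage_cost : nat;                       (* c *)
  fixed_cost   : 'I_suppliers -> nat;       (* alpha_i *)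
  unit_cost    : 'I_suppliers -> nat;       (* beta_i *)
  min_volume   : 'I_suppliers -> nat;       (* m_i *)
  max_volume   : 'I_suppliers -> nat;       (* M_i *)
  suppliers_gt0    : (0 < suppliers)%N;
  demand_gt0       : (0 < demand)%N;
  intensity_gt0    : (0 < intensity)%N;
  storage_cost_gt0 : (0 < storage_cost)%N;
  volume_le        : forall i, (min_volume i <= max_volume i)%N }.

Section Problem.
Variables (R : realType) (I : problem).
Implicit Type x : 'I_(suppliers I) -> R.

Definition delivery_cost (i : 'I_(suppliers I)) (v : R) : R :=
  if v == 0 then 0 else (fixed_cost i)%:R + (unit_cost i)%:R * v.

Definition total_cost x : R :=
  \sum_i delivery_cost i (x i)
  + \sum_i ((storage_cost I)%:R * x i ^+ 2) / (2 * (intensity I)%:R).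

Definition feasible x : Prop :=
  (demand I)%:R <= \sum_i x i /\
  forall i, x i = 0 \/ (min_volume i)%:R <= x i <= (max_volume i)%:R.

Definition optimal x : Prop :=
  feasible x /\ forall y, feasible y -> total_cost x <= total_cost y.

End Problem.

(** * Algorithms and their number of operations *)

(* Algorithms are programs of a random access machine with unit-cost exact
   arithmetic, computing on rational numbers only, since the inputs and the
   constants of programs are integers.  The store has registers and arrays,
   both named by natural numbers; a program mentions finitely many of them,
   and one program has to serve all inputs, whatever the number of suppliers.
   There is no rounding operation: an array is indexed by a number that must
   happen to be a natural number. *)

Record store := Store { reg : nat -> rat; arr : nat -> nat -> rat }.

Definition set_reg (s : store) (r : nat) (v : rat) : store :=
  Store (fun r' => if r' == r then v else reg s r') (arr s).

Definition set_arr (s : store) (a i : nat) (v : rat) : store :=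
  Store (reg s)
    (fun a' i' => if (a' == a) && (i' == i) then v else arr s a' i').

Inductive arith_op := Add | Sub | Mul | Div.

Inductive comparison_op := Eq | Le | Lt.

Inductive expr :=
  | Const of int
  | Reg of nat
  | Cell of nat & expr
  | Op of arith_op & expr & expr.

Inductive test := Test of comparison_op & expr & expr.

Inductive program :=
  | Skip
  | SetReg of nat & expr
  | SetCell of nat & expr & expr
  | Seq of program & program
  | If of test & program & program
  | While of test & program.

(* Evaluation is undefined on division by zero and on indices that are not
   natural numbers; a program evaluating such an expression is stuck. *)
Definition index_of (q : rat) : option nat :=
  if q \is a Num.nat then Some (Num.truncn q) else None.

Definition apply_op (o : arith_op) (u v : rat) : option rat :=
  match o with
  | Add => Some (u + v)
  | Sub => Some (u - v)
  | Mul => Some (u * v)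
  | Div => if v == 0 then None else Some (u / v)
  end.

Definition apply_cmp (o : comparison_op) (u v : rat) : bool :=
  match o with Eq => u == v | Le => u <= v | Lt => u < v end.

Fixpoint eval (s : store) (e : expr) : option rat :=
  match e with
  | Const z => Some z%:~R
  | Reg r => Some (reg s r)
  | Cell a e1 =>
      obind (fun q => omap (arr s a) (index_of q)) (eval s e1)
  | Op o e1 e2 =>
      obind (fun u => obind (apply_op o u) (eval s e2)) (eval s e1)
  end.

Definition eval_test (s : store) (b : test) : option bool :=
  let: Test o e1 e2 := b in
  obind (fun u => omap (apply_cmp o u) (eval s e2)) (eval s e1).

(* Besides arithmetic operations and comparisons, every constant, every
   memory access and every assignment is charged one operation as well, so
   that no step of a computation is free. *)
Fixpoint expr_ops (e : expr) : nat :=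
  match e with
  | Const _ | Reg _ => 1
  | Cell _ e1 => (expr_ops e1).+1
  | Op _ e1 e2 => (expr_ops e1 + expr_ops e2).+1
  end.

Definition test_ops (b : test) : nat :=
  let: Test _ e1 e2 := b in (expr_ops e1 + expr_ops e2).+1.

(* [exec p s t s']: started in [s], the program [p] halts in [s'] after [t]
   operations. *)
Inductive exec : program -> store -> nat -> store -> Prop :=
  | ExecSkip s : exec Skip s 0 s
  | ExecSetReg s r e v :
      eval s e = Some v ->
      exec (SetReg r e) s (expr_ops e).+1 (set_reg s r v)
  | ExecSetCell s a ei e q i v :
      eval s ei = Some q -> index_of q = Some i -> eval s e = Some v ->
      exec (SetCell a ei e) s (expr_ops ei + expr_ops e).+1 (set_arr s a i v)
  | ExecSeq p1 p2 s1 s2 s3 t1 t2 :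
      exec p1 s1 t1 s2 -> exec p2 s2 t2 s3 ->
      exec (Seq p1 p2) s1 (t1 + t2) s3
  | ExecIfTrue b p1 p2 s s' t :
      eval_test s b = Some true -> exec p1 s t s' ->
      exec (If b p1 p2) s (test_ops b + t) s'
  | ExecIfFalse b p1 p2 s s' t :
      eval_test s b = Some false -> exec p2 s t s' ->
      exec (If b p1 p2) s (test_ops b + t) s'
  | ExecWhileFalse b p s :
      eval_test s b = Some false ->
      exec (While b p) s (test_ops b) s
  | ExecWhileTrue b p s1 s2 s3 t1 t2 :
      eval_test s1 b = Some true ->
      exec p s1 t1 s2 -> exec (While b p) s2 t2 s3 ->
      exec (While b p) s1 (test_ops b + t1 + t2) s3.

Lemma exec_deterministic p s t1 s1 t2 s2 :
  exec p s t1 s1 -> exec p s t2 s2 -> t1 = t2 /\ s1 = s2.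
Proof.
move=> E; elim: E t2 s2 => {p s t1 s1}.
- by move=> s t2 s2 E; inversion E.
- by move=> s r e v ev t2 s2 E; inversion E; subst; split=> //; congruence.
- move=> s a ei e q i v eq_q eq_i ev t2 s2 E; inversion E; subst.
  by split=> //; congruence.
- move=> p1 p2 s1 s2 s3 t1 t2 _ IH1 _ IH2 t s E; inversion E; subst.
  have [-> e2] := IH1 _ _ ltac:(eassumption); subst.
  by have [-> ->] := IH2 _ _ ltac:(eassumption).
- move=> b p1 p2 s s' t eb _ IH t2 s2 E; inversion E; subst; last congruence.
  by have [-> ->] := IH _ _ ltac:(eassumption).
- move=> b p1 p2 s s' t eb _ IH t2 s2 E; inversion E; subst; first congruence.
  by have [-> ->] := IH _ _ ltac:(eassumption).
- by move=> b p s eb t2 s2 E; inversion E; subst; [split | congruence].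
- move=> b p s1 s2 s3 t1 t2 eb _ IH1 _ IH2 t s E; inversion E; subst.
    congruence.
  have [-> e2] := IH1 _ _ ltac:(eassumption); subst.
  by have [-> ->] := IH2 _ _ ltac:(eassumption).
Qed.

(** * Solving the problem *)

Definition ord_fun (n : nat) (f : 'I_n -> nat) (i : nat) : rat :=
  if insub i is Some j then (f j)%:R else 0.

(* Registers 0-3 contain n, P, lambda, c and arrays 0-3 contain alpha, beta,
   m, M (with indices starting from 0); all the rest is zero. *)
Definition input (I : problem) : store :=
  Store
    (fun r => match r with
              | 0%N => (suppliers I)%:R
              | 1%N => (demand I)%:R
              | 2%N => (intensity I)%:R
              | 3%N => (storage_cost I)%:R
              | _ => 0
              end)
    (fun a => match a with
              | 0%N => ord_fun (@fixed_cost I)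
              | 1%N => ord_fun (@unit_cost I)
              | 2%N => ord_fun (@min_volume I)
              | 3%N => ord_fun (@max_volume I)
              | _ => fun=> 0
              end).

(* The output is read from register 0 (1 or 0, according to whether there is
   a feasible vector), register 1 (the optimal value) and array 0 (an optimal
   solution).  Optimality is among all real vectors. *)
Definition correct_output (R : realType) (I : problem) (s : store) : Prop :=
  let x := fun i : 'I_(suppliers I) => ratr (arr s 0%N i) : R in
  ((exists y : 'I_(suppliers I) -> R, feasible y) ->
     [/\ reg s 0%N = 1, optimal x & ratr (reg s 1%N) = total_cost x]) /\
  (~ (exists y : 'I_(suppliers I) -> R, feasible y) -> reg s 0%N = 0).

Definition solves (R : realType) (A : program) : Prop :=
  forall I : problem,
    exists t s, exec A (input I) t s /\ correct_output R I s.

Definition ops_at_most (A : program) (T : problem -> nat) : Prop :=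
  forall (I : problem) t s, exec A (input I) t s -> (t <= T I)%N.

Definition ops_bigO (A : program) (T : problem -> nat) : Prop :=
  exists C : nat, ops_at_most A (fun I => C * T I)%N.

Definition number_of_parameters (I : problem) : nat :=
  (4 + 4 * suppliers I)%N.

Definition sum_of_parameters (I : problem) : nat :=
  (suppliers I + demand I + intensity I + storage_cost I
   + \sum_(i < suppliers I)
       (fixed_cost i + unit_cost i + min_volume i + max_volume i))%N.

(* Every polynomial in the number of parameters and their values is at most
   C * (number + sum) ^ d for some constants C and d, and conversely the
   latter is such a polynomial. *)
Definition pseudopolynomial (A : program) : Prop :=
  exists d : nat,
    ops_bigO A (fun I => (number_of_parameters I + sum_of_parameters I) ^ d)%N.

(* The total length of the volume intervals, replaced by 1 if they are all
   reduced to a point, as a bound of 0 operations would be meaningless. *)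
Definition total_range (I : problem) : nat :=
  maxn 1 (\sum_(k < suppliers I) (max_volume k - min_volume k)).

(* Main.v *)
Require Import Defs.
From mathcomp Require Import all_boot all_order all_algebra.
From mathcomp Require Import reals.
From mathcomp Require Import zify ring lra.

(** The problem is discretized without loss. Fix a feasible vector and vary
    the volumes of its active suppliers between their bounds. They can be
    lowered until the demand is met exactly or all of them are minimal. In the
    second case, as when no volume is strictly between its bounds, they are
    integers and lie on every grid below. Otherwise let [K] be the set of
    coordinates strictly between their bounds and [k] its cardinal: the cost
    is a separable strictly convex quadratic function with the common leading
    coefficient [c / (2 lambda)], so its minimizer when only the coordinates
    in [K] vary, with a fixed sum, is given by an explicit Lagrange
    multiplier. The other coordinates being integers, [c k] times this
    minimizer is an integer vector. If the minimizer satisfies the volume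
    constraints, it is a vector of the grid of step [1 / (c k)] with no larger
    cost; otherwise moving towards it until the first bound is reached does
    not raise the cost and shrinks [K]. So some [k <= n] provides a grid
    vector at least as good as the given one ([round_to_grid]).

    For a given [k], with [q = c k], the best vector on the grid of step
    [1 / q] is found by dynamic programming over the suppliers and the
    residual demand, an integer between [0] and [P q] in units of [1 / q]. A
    residual demand left unmet at the end costs a penalty that exceeds the cost
    of delivering all maximal volumes, so that the recursion needs no infinite
    value and the problem is feasible exactly when the optimum is below the
    penalty ([best_cost_le], [penalized_cost_plan], [best_solution_optimal]).
    Supplier [i] has [q (M_i - m_i) + 1] options besides zero, so one grid takes
    [O(P q (q * sum_i (M_i - m_i) + n))] operations, and summing over [k <= n]
    gives the bound ([solver_time_le]). Choices are tabulated, and an optimal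
    vector is read off in [n] further steps ([plan_prog_runs]).

    The program is verified by total correctness triples that carry a bound on
    the number of operations ([runs]): it computes the values of the recursive
    functions that define the dynamic programming ([solver_runs]), and only
    these functions are compared with the real problem. *)

Set Implicit Arguments.
Unset Strict Implicit.
Unset Printing Implicit Defensive.

Import Order.TTheory GRing.Theory Num.Theory.
Local Open Scope ring_scope.

(** * Total correctness with operation bounds *)

(** Registers and arrays to which a program assigns. *)
Fixpoint written_regs (p : program) : seq nat :=
  match p with
  | Skip | SetCell _ _ _ => [::]
  | SetReg r _ => [:: r]
  | Seq p1 p2 | If _ p1 p2 => written_regs p1 ++ written_regs p2
  | While _ p1 => written_regs p1
  end.

Fixpoint written_arrs (p : program) : seq nat :=
  match p with
  | Skip | SetReg _ _ => [::]
  | SetCell a _ _ => [:: a]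
  | Seq p1 p2 | If _ p1 p2 => written_arrs p1 ++ written_arrs p2
  | While _ p1 => written_arrs p1
  end.

(** [s'] agrees with [s] wherever [p] has no assignment. *)
Definition agree (p : program) (s s' : store) : Prop :=
  (forall r, r \notin written_regs p -> reg s' r = reg s r) /\
  (forall a, a \notin written_arrs p -> arr s' a = arr s a).

Lemma agree_refl p s : agree p s s.
Proof. by []. Qed.

Lemma agree_trans p s1 s2 s3 : agree p s1 s2 -> agree p s2 s3 -> agree p s1 s3.
Proof.
by move=> [r1 a1] [r2 a2]; split=> [r | a] out; rewrite ?r2 ?a2 ?r1 ?a1.
Qed.

(** The frame property. *)
Lemma exec_agree p s t s' : exec p s t s' -> agree p s s'.
Proof.
elim=> {p s t s'} //=.
- move=> s r e v _; split=> //= r'; rewrite inE => /negbTE; by move=> ->.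
- move=> s a ei e q i v _ _ _; split=> //= a'; rewrite inE => /negbTE -> //.
- move=> p1 p2 s1 s2 s3 t1 t2 _ [r1 a1] _ [r2 a2].
  split=> [r | a] /=; rewrite mem_cat => /norP[out1 out2].
    by rewrite r2 // r1.
  by rewrite a2 // a1.
- move=> b p1 p2 s s' t _ _ [r1 a1].
  by split=> [r | a] /=; rewrite mem_cat => /norP[? ?]; auto.
- move=> b p1 p2 s s' t _ _ [r1 a1].
  by split=> [r | a] /=; rewrite mem_cat => /norP[? ?]; auto.
- move=> b p s1 s2 s3 t1 t2 _ _ ag1 _ ag2; exact: agree_trans ag1 ag2.
Qed.

(** Started in [s], the program [p] halts after at most [B] operations, in a
    store that satisfies [Q]. *)
Definition runs (p : program) (s : store) (B : nat) (Q : store -> Prop) : Prop :=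
  exists t s', [/\ exec p s t s', (t <= B)%N & Q s'].

Lemma runs_conseq p s (B B' : nat) (Q Q' : store -> Prop) :
  runs p s B Q -> (B <= B')%N -> (forall s', agree p s s' -> Q s' -> Q' s') ->
  runs p s B' Q'.
Proof.
move=> [t [s' [ex le_t Qs']]] le_B QQ'; exists t, s'; split=> //.
  exact: leq_trans le_t le_B.
by apply: QQ' => //; apply: exec_agree ex.
Qed.

Lemma runs_le p s (B B' : nat) (Q : store -> Prop) :
  runs p s B Q -> (B <= B')%N -> runs p s B' Q.
Proof. by move=> run le_B; apply: runs_conseq run le_B _. Qed.

Lemma runs_skip s (Q : store -> Prop) : Q s -> runs Skip s 0 Q.
Proof. by move=> Qs; exists 0%N, s; split=> //; constructor. Qed.

Lemma runs_reg s r e v (Q : store -> Prop) :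
  eval s e = Some v -> Q (set_reg s r v) -> runs (SetReg r e) s (expr_ops e).+1 Q.
Proof.
by move=> ev Qs; exists (expr_ops e).+1, (set_reg s r v); split=> //; constructor.
Qed.

Lemma runs_cell s a ei e (i : nat) v (Q : store -> Prop) :
  eval s ei = Some i%:R -> eval s e = Some v -> Q (set_arr s a i v) ->
  runs (SetCell a ei e) s (expr_ops ei + expr_ops e).+1 Q.
Proof.
move=> evi ev Qs; exists (expr_ops ei + expr_ops e).+1, (set_arr s a i v).
split=> //; apply: ExecSetCell evi _ ev.
by rewrite /index_of natr_nat natrK.
Qed.

Lemma runs_seq p1 p2 s (B1 B2 : nat) (Q : store -> Prop) :
  runs p1 s B1 (fun s1 => runs p2 s1 B2 Q) -> runs (Seq p1 p2) s (B1 + B2) Q.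
Proof.
move=> [t1 [s1 [ex1 le1 [t2 [s2 [ex2 le2 Qs]]]]]].
exists (t1 + t2)%N, s2; split=> //; first exact: ExecSeq ex1 ex2.
exact: leq_add.
Qed.

(** The variant for a first program whose final store is known. *)
Lemma runs_seq_eq p1 p2 s s1 (B1 B2 : nat) (Q : store -> Prop) :
  runs p1 s B1 (eq^~ s1) -> runs p2 s1 B2 Q -> runs (Seq p1 p2) s (B1 + B2) Q.
Proof.
move=> run1 run2; apply: runs_seq; apply: runs_conseq run1 (leqnn _) _.
by move=> _ _ ->.
Qed.

Lemma runs_if b (v : bool) p1 p2 s (B1 B2 : nat) (Q : store -> Prop) :
  eval_test s b = Some v ->
  (v -> runs p1 s B1 Q) -> (~~ v -> runs p2 s B2 Q) ->
  runs (If b p1 p2) s (test_ops b + (B1 + B2)) Q.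
Proof.
case: v => ev run1 run2.
  have [t [s' [ex le_t Qs]]] := run1 isT; exists (test_ops b + t)%N, s'.
  split=> //; first exact: ExecIfTrue.
  by rewrite leq_add2l (leq_trans le_t) // leq_addr.
have [t [s' [ex le_t Qs]]] := run2 isT; exists (test_ops b + t)%N, s'.
split=> //; first exact: ExecIfFalse.
by rewrite leq_add2l (leq_trans le_t) // leq_addl.
Qed.

(** A loop of exactly [N] rounds, the [i]-th one of which takes at most
    [B i] operations and turns the invariant [Inv i] into [Inv i.+1]. *)
Lemma runs_while b p s (N : nat) (B : nat -> nat)
    (Inv : nat -> store -> Prop) (Q : store -> Prop) :
  Inv 0%N s ->
  (forall i s', (i < N)%N -> agree p s s' -> Inv i s' ->
     eval_test s' b = Some true /\ runs p s' (B i) (Inv i.+1)) ->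
  (forall s', agree p s s' -> Inv N s' -> eval_test s' b = Some false /\ Q s') ->
  runs (While b p) s (\sum_(i < N) (test_ops b + B i) + test_ops b) Q.
Proof.
move=> Inv0 step stop.
suff loop d : forall i s', (i + d = N)%N -> agree p s s' -> Inv i s' ->
    runs (While b p) s' (\sum_(i <= l < N) (test_ops b + B l) + test_ops b) Q.
  by have := loop N 0%N s (erefl N) (agree_refl p s) Inv0; rewrite big_mkord.
elim: d => [|d IHd] i s' eq_N ag Invi.
  rewrite addn0 in eq_N; rewrite eq_N in Invi; have [ev Qs] := stop _ ag Invi.
  by exists (test_ops b), s'; split; [exact: ExecWhileFalse | rewrite leq_addl |].
have lt_iN : (i < N)%N by rewrite -eq_N -addSnnS leq_addr.
have [ev [t1 [s1 [ex1 le1 Inv1]]]] := step _ _ lt_iN ag Invi.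
have ag1 := agree_trans ag (exec_agree ex1).
have [|t2 [s2 [ex2 le2 Qs]]] := IHd i.+1 s1 _ ag1 Inv1; first by rewrite addSnnS.
exists (test_ops b + t1 + t2)%N, s2; split=> //; first exact: ExecWhileTrue ex1 ex2.
by rewrite big_ltn // -[leqRHS]addnA leq_add // leq_add2l.
Qed.

(** ** Evaluation of expressions

    The suffix [n] marks the versions for values that are natural numbers, which
    is the form that array indices require. *)

Lemma eval_cell s a e (i : nat) :
  eval s e = Some i%:R -> eval s (Cell a e) = Some (arr s a i).
Proof. by move=> /= ->; rewrite /= /index_of natr_nat natrK. Qed.

Lemma eval_add s e1 e2 u v : eval s e1 = Some u -> eval s e2 = Some v ->
  eval s (Op Add e1 e2) = Some (u + v).
Proof. by move=> /= -> ->. Qed.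

Lemma eval_mul s e1 e2 u v : eval s e1 = Some u -> eval s e2 = Some v ->
  eval s (Op Mul e1 e2) = Some (u * v).
Proof. by move=> /= -> ->. Qed.

Lemma eval_div s e1 e2 u v : v != 0 ->
  eval s e1 = Some u -> eval s e2 = Some v -> eval s (Op Div e1 e2) = Some (u / v).
Proof. by move=> /= /negbTE v0 -> /= -> /=; rewrite v0. Qed.

Lemma eval_addn s e1 e2 (i j : nat) :
  eval s e1 = Some i%:R -> eval s e2 = Some j%:R ->
  eval s (Op Add e1 e2) = Some (i + j)%:R.
Proof. by move=> /= -> ->; rewrite natrD. Qed.

Lemma eval_subn s e1 e2 (i j : nat) : (j <= i)%N ->
  eval s e1 = Some i%:R -> eval s e2 = Some j%:R ->
  eval s (Op Defs.Sub e1 e2) = Some (i - j)%:R.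
Proof. by move=> le_ji /= -> ->; rewrite natrB. Qed.

Lemma eval_muln s e1 e2 (i j : nat) :
  eval s e1 = Some i%:R -> eval s e2 = Some j%:R ->
  eval s (Op Mul e1 e2) = Some (i * j)%:R.
Proof. by move=> /= -> ->; rewrite natrM. Qed.

Lemma eval_lt s e1 e2 u v : eval s e1 = Some u -> eval s e2 = Some v ->
  eval_test s (Test Lt e1 e2) = Some (u < v).
Proof. by move=> /= -> ->. Qed.

Lemma eval_ltn s e1 e2 (i j : nat) :
  eval s e1 = Some i%:R -> eval s e2 = Some j%:R ->
  eval_test s (Test Lt e1 e2) = Some (i < j)%N.
Proof. by move=> /= -> ->; rewrite /= ltr_nat. Qed.

Lemma eval_leq s e1 e2 (i j : nat) :
  eval s e1 = Some i%:R -> eval s e2 = Some j%:R ->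
  eval_test s (Test Le e1 e2) = Some (i <= j)%N.
Proof. by move=> /= -> ->; rewrite /= ler_nat. Qed.

(** * Rounding feasible vectors to a grid *)

Section Rounding.
Variables (R : realType) (n P la c : nat) (be lo hi : 'I_n -> nat).
Hypotheses (n_gt0 : (0 < n)%N) (la_gt0 : (0 < la)%N) (c_gt0 : (0 < c)%N).
Hypothesis le_lohi : forall i, (lo i <= hi i)%N.
Implicit Types (x y z : 'I_n -> R).

Let ga : R := c%:R / (2 * la%:R).
Let rla : (0 : R) < la%:R. Proof. by rewrite ltr0n. Qed.
Let rc : (0 : R) < c%:R. Proof. by rewrite ltr0n. Qed.
Let ga_gt0 : 0 < ga. Proof. by rewrite divr_gt0 // mulr_gt0. Qed.

(** Cost without the fixed costs. It is convex, also at [0]. *)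
Definition convex_cost x : R :=
  \sum_i ((be i)%:R * x i + (c%:R * x i ^+ 2) / (2 * la%:R)).

Definition in_box x : Prop := forall i, (lo i)%:R <= x i <= (hi i)%:R.

(** The set [K] of coordinates strictly between their bounds. *)
Definition free_coords x : {set 'I_n} :=
  [set i | (lo i)%:R < x i < (hi i)%:R].

(** The Lagrange multiplier, and below it the minimizer, of the cost as a
    function of the free coordinates of [y] with their sum fixed. *)
Definition free_multiplier y : R :=
  ((\sum_(i in free_coords y) y i) * c%:R / la%:R
     + \sum_(i in free_coords y) (be i)%:R) / #|free_coords y|%:R.

Definition free_minimizer y i : R :=
  if i \in free_coords y then (free_multiplier y - (be i)%:R) * la%:R / c%:R
  else y i.

Lemma sum_free_minimizer y :
  (0 < #|free_coords y|)%N -> \sum_i free_minimizer y i = \sum_i y i.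
Proof.
move=> K_gt0; have rK : (0 : R) < #|free_coords y|%:R by rewrite ltr0n.
rewrite (bigID (mem (free_coords y))) [RHS](bigID (mem (free_coords y))) /=.
congr (_ + _); last first.
  by apply: eq_bigr => i /negbTE out; rewrite /free_minimizer out.
rewrite (eq_bigr (fun i => free_multiplier y * la%:R / c%:R
                           - (be i)%:R * (la%:R / c%:R))); last first.
  by move=> i iK; rewrite /free_minimizer iK; ring.
rewrite sumrB sumr_const -mulr_suml -mulr_natr /free_multiplier.
by field; rewrite !gt_eqF.
Qed.

(** Along the line through [y] and the minimizer the first-order terms cancel:
    the derivative of the cost at the minimizer is the multiplier in every free
    coordinate, and the displacement has sum [0]. *)
Lemma convex_cost_minimizer y (s : R) x :
  (0 < #|free_coords y|)%N ->
  (forall i, x i = free_minimizer y i + s * (y i - free_minimizer y i)) ->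
  convex_cost x = convex_cost (free_minimizer y)
    + s ^+ 2 * (ga * \sum_i (y i - free_minimizer y i) ^+ 2).
Proof.
move=> K_gt0 xE; set z := free_minimizer y; set mu := free_multiplier y.
have sum0 : \sum_i (y i - z i) = 0.
  by rewrite sumrB sum_free_minimizer // subrr.
have -> : convex_cost x =
    \sum_i ((be i)%:R * z i + c%:R * z i ^+ 2 / (2 * la%:R)
            + (mu * s * (y i - z i) + s ^+ 2 * (ga * (y i - z i) ^+ 2))).
  apply: eq_bigr => i _; rewrite xE -/z /ga.
  have [iK | iK] := boolP (i \in free_coords y); last first.
    have -> : z i = y i by rewrite /z /free_minimizer (negbTE iK).
    by ring.
  have -> : z i = (mu - (be i)%:R) * la%:R / c%:R by rewrite /z /free_minimizer iK.
  by field; rewrite !gt_eqF.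
rewrite big_split /=; congr (_ + _).
by rewrite big_split /= -mulr_sumr sum0 mulr0 add0r -!mulr_sumr.
Qed.

Lemma convex_cost_toward y (th : R) :
  (0 < #|free_coords y|)%N -> 0 <= th <= 1 ->
  convex_cost (fun i => y i + th * (free_minimizer y i - y i)) <= convex_cost y.
Proof.
move=> K_gt0 th01; set z := free_minimizer y.
rewrite (@convex_cost_minimizer y (1 - th)) // => [|i]; last by rewrite -/z; ring.
rewrite [leRHS](@convex_cost_minimizer y 1) // => [|i]; last by rewrite -/z; ring.
rewrite lerD2l; apply: ler_wpM2r; last by nra.
by apply: mulr_ge0 (ltW ga_gt0) _; apply: sumr_ge0 => i _; apply: sqr_ge0.
Qed.

(** [a] consists of volumes between the bounds, in units of [1 / (c k)]. *)
Definition on_grid (k : nat) (a : 'I_n -> nat) : Prop :=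
  (forall i, (c * k * lo i <= a i <= c * k * hi i)%N).

Lemma bound_nat y i : in_box y -> i \notin free_coords y -> y i \is a Num.nat.
Proof.
move=> /(_ i) /andP[ge_lo le_hi]; rewrite inE negb_and -!leNgt => /orP[le | ge].
  by have -> : y i = (lo i)%:R by apply/le_anti; rewrite le.
by have -> : y i = (hi i)%:R by apply/le_anti; rewrite le_hi.
Qed.

Lemma bound_int y i : in_box y -> i \notin free_coords y -> y i \is a Num.int.
Proof. by move=> boxy out; have := bound_nat boxy out; rewrite natrEint => /andP[]. Qed.

Lemma grid_of_nat x (k : nat) : (0 < k)%N -> in_box x ->
  (forall i, (c * k)%:R * x i \is a Num.nat) ->
  exists2 a, on_grid k a & forall i, x i = (a i)%:R / (c * k)%:R.
Proof.
move=> k_gt0 box isnat; exists (fun i => Num.truncn ((c * k)%:R * x i)) => i.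
  have := box i; rewrite -!(@ler_nat R) truncnK // !natrM => /andP[ge_lo le_hi].
  have ck_gt0 : (0 : R) < c%:R * k%:R by rewrite mulr_gt0 // ltr0n.
  by rewrite !ler_pM2l // ge_lo.
rewrite truncnK // mulrAC mulfV ?mul1r //.
by rewrite pnatr_eq0 muln_eq0 negb_or -!lt0n c_gt0.
Qed.

(** The sum of the free coordinates is an integer, being the difference of [P]
    and of coordinates at their bounds. *)
Lemma minimizer_grid y : in_box y -> \sum_i y i = P%:R ->
  (0 < #|free_coords y|)%N -> in_box (free_minimizer y) ->
  forall i, (c * #|free_coords y|)%:R * free_minimizer y i \is a Num.nat.
Proof.
move=> boxy sumy K_gt0 boxz i.
have rK : (0 : R) < #|free_coords y|%:R by rewrite ltr0n.
rewrite natrEint; apply/andP; split; last first.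
  apply: mulr_ge0; first exact: ler0n.
  by have /andP[ge_lo _] := boxz i; apply: le_trans ge_lo; rewrite ler0n.
rewrite /free_minimizer; case: ifP => [iK | /negbT iK]; last first.
  by rewrite rpredM ?rpred_nat // bound_int.
have -> : (c * #|free_coords y|)%:R
    * ((free_multiplier y - (be i)%:R) * la%:R / c%:R)
  = (\sum_(i in free_coords y) y i) * c%:R
    + la%:R * \sum_(i in free_coords y) (be i)%:R
    - la%:R * (#|free_coords y|%:R * (be i)%:R) :> R.
  by rewrite natrM /free_multiplier; field; rewrite !gt_eqF.
have -> : \sum_(i in free_coords y) y i
    = P%:R - \sum_(i | i \notin free_coords y) y i.
  by rewrite -sumy (bigID (mem (free_coords y)) predT) /= addrK.
have intS : \sum_(j | j \notin free_coords y) y j \is a Num.int.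
  by apply: rpred_sum => j jK; exact: bound_int.
have intB : \sum_(j in free_coords y) (be j)%:R \is a @Num.int R.
  by apply: rpred_sum => j _; apply: rpred_nat.
by rewrite rpredB ?rpredD ?rpredM ?rpredB ?rpred_nat.
Qed.

(** If the minimizer violates the bounds, one can go from [y] towards it until a
    free coordinate reaches a bound. *)
Lemma step_to_bound y : in_box y -> (0 < #|free_coords y|)%N ->
  ~ in_box (free_minimizer y) ->
  exists x, [/\ in_box x, \sum_i x i = \sum_i y i,
    convex_cost x <= convex_cost y & (#|free_coords x| < #|free_coords y|)%N].
Proof.
move=> boxy K_gt0 out; set z := free_minimizer y in out *.
(* [th i] is the fraction of the way at which coordinate [i] leaves the box,
   or [1] if it does not. *)
pose th i : R := if (hi i)%:R < z i then ((hi i)%:R - y i) / (z i - y i)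
  else if z i < (lo i)%:R then (y i - (lo i)%:R) / (y i - z i) else 1.
have [i0 i0out] : exists i0, ~~ ((lo i0)%:R <= z i0 <= (hi i0)%:R).
  apply/existsP; rewrite -negb_forall; apply/negP => /forallP box.
  by apply: out => i; exact: box.
have th_bound i : [/\ 0 <= th i <= 1,
    th i < 1 -> y i + th i * (z i - y i) \in [:: (lo i)%:R; (hi i)%:R],
    ~~ ((lo i)%:R <= z i <= (hi i)%:R) -> th i < 1 &
    forall u, 0 <= u <= th i -> (lo i)%:R <= y i + u * (z i - y i) <= (hi i)%:R].
  rewrite /th !inE; have /andP[y1 y2] := boxy i.
  case: (ltrP (hi i)%:R (z i)) => [hz | hz].
    have d_gt0 : 0 < z i - y i by lra.
    split.
    - by rewrite divr_ge0 /= ?ler_pdivrMr //; lra.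
    - have -> : y i + ((hi i)%:R - y i) / (z i - y i) * (z i - y i) = (hi i)%:R.
        by field; rewrite gt_eqF.
      by rewrite eqxx orbT.
    - by move=> _; rewrite ltr_pdivrMr //; lra.
    - move=> u /andP[u_ge0]; rewrite ler_pdivlMr // => u_le.
      have := mulr_ge0 u_ge0 (ltW d_gt0); lra.
  case: (ltrP (z i) (lo i)%:R) => [lz | lz].
    have d_gt0 : 0 < y i - z i by lra.
    split.
    - by rewrite divr_ge0 /= ?ler_pdivrMr //; lra.
    - have -> : y i + (y i - (lo i)%:R) / (y i - z i) * (z i - y i) = (lo i)%:R.
        by field; rewrite gt_eqF.
      by rewrite eqxx.
    - by move=> _; rewrite ltr_pdivrMr //; lra.
    - move=> u /andP[u_ge0]; rewrite ler_pdivlMr // => u_le.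
      have := mulr_ge0 u_ge0 (ltW d_gt0); lra.
  split.
  - by rewrite ler01 lexx.
  - by rewrite ltxx.
  - by [].
  - by move=> u /andP[u0 u1]; nra.
pose i1 := [arg min_(i < i0) th i]%O.
have th_min i : th i1 <= th i.
  by rewrite /i1; case: arg_minP => // j _; apply.
have [th01 at_bound _ _] := th_bound i1.
have [_ _ th0 _] := th_bound i0.
have th1_lt1 : th i1 < 1 := le_lt_trans (th_min i0) (th0 i0out).
exists (fun i => y i + th i1 * (z i - y i)); split.
- move=> i; have [_ _ _ ->] := th_bound i => //.
  by rewrite th_min andbT; case/andP: th01.
- by rewrite big_split /= -mulr_sumr sumrB sum_free_minimizer // subrr mulr0 addr0.
- exact: convex_cost_toward.
- apply: proper_card; apply/properP; split.
    apply/subsetP => i; apply: contraLR => iK.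
    have -> // : (i \in free_coords (fun i => y i + th i1 * (z i - y i)))
      = (i \in free_coords y).
    rewrite [LHS]inE [RHS]inE /z /free_minimizer (negbTE iK).
    by rewrite subrr mulr0 addr0.
  exists i1.
    apply/negPn/negP => iK.
    have zE : z i1 = y i1 by rewrite /z /free_minimizer (negbTE iK).
    by move: th1_lt1; rewrite /th zE; have /andP[] := boxy i1;
      rewrite 2!leNgt => /negbTE -> /negbTE ->; rewrite ltxx.
  rewrite inE; have := at_bound th1_lt1; rewrite !inE => /orP[] /eqP ->;
    by rewrite ltxx ?andbF.
Qed.

(** Any point of the box that meets the demand exactly is matched by a grid
    point, by induction on the number of free coordinates. *)
Lemma round_tight y : in_box y -> \sum_i y i = P%:R ->
  exists k a, [/\ (0 < k <= n)%N, on_grid k a, \sum_i a i = (P * (c * k))%N &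
    convex_cost (fun i => (a i)%:R / (c * k)%:R) <= convex_cost y].
Proof.
move: {2}_.+1 (ltnSn #|free_coords y|) => N; elim: N y => // N IHN y ltN boxy sumy.
suff to_grid x k : (0 < k <= n)%N -> in_box x -> \sum_i x i = P%:R ->
    convex_cost x <= convex_cost y ->
    (forall i, (c * k)%:R * x i \is a Num.nat) ->
    exists k a, [/\ (0 < k <= n)%N, on_grid k a, \sum_i a i = (P * (c * k))%N &
    convex_cost (fun i => (a i)%:R / (c * k)%:R) <= convex_cost y].
  have [/eqP K0 | ] := posnP #|free_coords y|.
    (* All coordinates are at their bounds, hence on the coarsest grid. *)
    apply: (to_grid y 1%N) => // i; rewrite muln1; apply: rpredM; first exact: natr_nat.
    by apply: bound_nat => //; move: K0; rewrite cards_eq0 => /eqP ->; rewrite inE.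
  move=> K_gt0; have [in_z | out_z] := boolP
    [forall i, (lo i)%:R <= free_minimizer y i <= (hi i)%:R].
    apply: (to_grid (free_minimizer y) #|free_coords y|).
    - by rewrite K_gt0 -[leqRHS]card_ord max_card.
    - exact/forallP.
    - by rewrite sum_free_minimizer.
    - apply: le_trans (convex_cost_toward (th := 1) K_gt0 _); last by rewrite lexx ler01.
      rewrite le_eqVlt; apply/orP; left; apply/eqP; apply: eq_bigr => i _.
      by rewrite mul1r [y i + _]addrC subrK.
    - by apply: minimizer_grid => //; apply/forallP.
  have [|x [boxx sumx costx ltx]] := step_to_bound boxy K_gt0.
    by move=> box; case/negP: out_z; apply/forallP.
  have [|||k [a [kn ag suma costa]]] := IHN x; rewrite ?sumx //.
    exact: leq_trans ltx ltN.
  by exists k, a; split=> //; apply: le_trans costx.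
move=> k_n boxx sumx costx isnat; have /andP[k_gt0 _] := k_n.
have [a ag xE] := grid_of_nat k_gt0 boxx isnat.
have ck0 : (c * k)%:R != 0 :> R.
  by rewrite pnatr_eq0 muln_eq0 negb_or -!lt0n c_gt0.
exists k, a; split=> //; last first.
  by rewrite (_ : convex_cost _ = convex_cost x) //; apply: eq_bigr => i _; rewrite xE.
apply/eqP; rewrite -(eqr_nat R) natr_sum natrM -sumx mulr_suml.
by apply/eqP/eq_bigr => i _; rewrite xE divfK.
Qed.

Lemma round_to_grid y : in_box y -> P%:R <= \sum_i y i ->
  exists k a, [/\ (0 < k <= n)%N, on_grid k a, (P * (c * k) <= \sum_i a i)%N &
    convex_cost (fun i => (a i)%:R / (c * k)%:R) <= convex_cost y].
Proof.
move=> boxy sumy.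
have monot x : (forall i, 0 <= x i <= y i) -> convex_cost x <= convex_cost y.
  move=> xy; apply: ler_sum => i _; have /andP[x0 xyi] := xy i.
  apply: lerD; first by rewrite ler_wpM2l ?ler0n.
  rewrite ler_wpM2r ?invr_ge0 ?mulr_ge0 ?ler0n // ler_wpM2l ?ler0n //.
  by rewrite lerXn2r ?nnegrE //; lra.
have lo_ge0 i : (0 : R) <= (lo i)%:R by rewrite ler0n.
have [le_P | lt_P] := lerP P%:R (\sum_i (lo i)%:R : R).
  have c0 : c%:R != 0 :> R by rewrite gt_eqF.
  exists 1%N, (fun i => c * lo i)%N; rewrite muln1; split=> //.
  - by move=> i; rewrite muln1 leqnn leq_mul2l le_lohi orbT.
  - by rewrite -big_distrr /= mulnC leq_mul2l -(ler_nat R) natr_sum le_P orbT.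
  - apply: monot => i; rewrite natrM mulrAC mulfV // mul1r lo_ge0.
    by case/andP: (boxy i).
(* Shrink the vector towards the lower bounds until the demand is tight. *)
set L := \sum_i _ in lt_P; set S := \sum_i _ in sumy.
have d_gt0 : 0 < S - L by lra.
pose th := (P%:R - L) / (S - L).
have th0 : 0 <= th by rewrite divr_ge0; lra.
have th1 : th <= 1 by rewrite ler_pdivrMr //; lra.
pose x i := (lo i)%:R + th * (y i - (lo i)%:R).
have xy i : (lo i)%:R <= x i <= y i by have /andP[? ?] := boxy i; rewrite /x; nra.
have [||k [a [kn ag suma costa]]] := @round_tight x.
- by move=> i; have := xy i; have := boxy i; lra.
- rewrite /x big_split /= -mulr_sumr sumrB -/S -/L /th divfK ?gt_eqF //; ring.
exists k, a; split=> //; first by rewrite suma.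
apply: le_trans costa _; apply: monot => i; have := xy i; have := lo_ge0 i; lra.
Qed.

End Rounding.

(** * Dynamic programming on grids *)

Section Recursion.
Variables (n P la c : nat) (al be mi ma : nat -> nat).
Hypothesis le_mima : forall i, (mi i <= ma i)%N.

(** Cost of a delivery from supplier [i] and of its storage, for [v] nonzero. *)
Definition active_cost (i : nat) (v : rat) : rat :=
  (al i)%:R + (be i)%:R * v + (c%:R * (v * v)) / (2 * la%:R).

(** A number above the cost of delivering the maximal volumes. *)
Definition penalty : rat := 1 + \sum_(i < n) active_cost i (ma i)%:R.

Lemma active_cost_ge0 i v : 0 <= v -> 0 <= active_cost i v.
Proof.
by move=> v0; rewrite !addr_ge0 ?mulr_ge0 ?invr_ge0 ?mulr_ge0 ?ler0n.
Qed.

Section Grid.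
(** Volumes are measured in units of [1 / q]. *)
Variable q : nat.

(** Cost of an amount [a], that is, of the volume [a / q]. *)
Definition amount_cost (i a : nat) : rat :=
  if a == 0%N then 0 else active_cost i (a%:R / q%:R).

Lemma amount_cost_le i a : amount_cost i a <= active_cost i (a%:R / q%:R).
Proof.
rewrite /amount_cost; case: ifP => // _.
by rewrite active_cost_ge0 // divr_ge0 ?ler0n.
Qed.

Lemma amount_cost_ge0 i a : 0 <= amount_cost i a.
Proof.
by rewrite /amount_cost; case: ifP => // _; rewrite active_cost_ge0 ?divr_ge0 ?ler0n.
Qed.

(** The amounts that supplier [i] may deliver. *)
Definition allowed (i a : nat) : Prop :=
  a = 0%N \/ (q * mi i <= a <= q * ma i)%N.

(** Number of amounts between the bounds of supplier [i]. *)
Definition option_count (i : nat) : nat := (q * ma i - q * mi i).+1.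

(** Cost of the amounts [x] for the first [i] suppliers, with the penalty if they
    do not meet the demand [j]. *)
Definition penalized_cost (i j : nat) (x : nat -> nat) : rat :=
  \sum_(l < i) amount_cost l (x l)
  + (if (j <= \sum_(l < i) x l)%N then 0 else penalty).

(** Least cost for a demand [j] and the amount that attains it, when supplier [i]
    delivers nothing or one of the first [t] amounts between its bounds, and
    [row] gives the least costs for the suppliers before [i]. Residual demands
    are truncated at [0] by the subtraction. When [m_i = 0] the zero amount is
    scanned once more as an active delivery, at a cost that is not lower. *)
Fixpoint scan (row : nat -> rat) (i j t : nat) : rat * nat :=
  if t is t'.+1 then
    let a := (q * mi i + t')%N in
    let v := row (j - a)%N + active_cost i (a%:R / q%:R) in
    if v < (scan row i j t').1 then (v, a) else scan row i j t'
  else (row j, 0%N).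

(** Least penalized cost for the first [i] suppliers and a demand [j]. *)
Fixpoint best_cost (i : nat) : nat -> rat :=
  if i is i'.+1 then fun j => (scan (best_cost i') i' j (option_count i')).1
  else fun j => if j == 0%N then 0 else penalty.

(** Amount of supplier [i] in an optimal choice for the first [i.+1] suppliers. *)
Definition best_amount (i j : nat) : nat :=
  (scan (best_cost i) i j (option_count i)).2.

(** Amounts [l < i] of an optimal choice for the first [i] suppliers. *)
Fixpoint best_plan (i j : nat) : nat -> nat :=
  if i is i'.+1 then fun l =>
    if l == i' then best_amount i' j
    else best_plan i' (j - best_amount i' j) l
  else fun=> 0%N.

Lemma penalized_costS i j x :
  penalized_cost i.+1 j x = penalized_cost i (j - x i) x + amount_cost i (x i).
Proof.
by rewrite /penalized_cost !big_ord_recr /= leq_subLR addnC addrAC [(x i + _)%N]addnC.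
Qed.

Lemma scan_le0 row i j t : (scan row i j t).1 <= row j.
Proof.
elim: t => //= t IH; case: ifP => // lt; exact: ltW (lt_le_trans lt IH).
Qed.

Lemma scan_le row i j t t' : (t' < t)%N ->
  (scan row i j t).1
    <= row (j - (q * mi i + t'))%N + active_cost i ((q * mi i + t')%:R / q%:R).
Proof.
elim: t => //= t IH; rewrite ltnS leq_eqVlt => /predU1P[-> | lt_t].
  by case: ltP.
by case: ifP => [/ltW lt|_]; [apply: le_trans lt _ |]; apply: IH.
Qed.

Lemma scan_attained row i j t : (t <= option_count i)%N ->
  allowed i (scan row i j t).2 /\
  row (j - (scan row i j t).2)%N + amount_cost i (scan row i j t).2
    <= (scan row i j t).1.
Proof.
elim: t => [|t IH] lt_t /=; first by rewrite subn0 addr0; split=> //; left.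
case: ifP => _ /=; last by apply: IH; apply: ltnW.
split; last by rewrite lerD2l amount_cost_le.
have : (q * mi i <= q * ma i)%N by rewrite leq_mul2l le_mima orbT.
by right; move: lt_t; rewrite /option_count; lia.
Qed.

Lemma best_cost_le i j x : (forall l, (l < i)%N -> allowed l (x l)) ->
  best_cost i j <= penalized_cost i j x.
Proof.
elim: i j => [|i IH] j ok.
  by rewrite /penalized_cost !big_ord0 add0r /= leqn0.
rewrite penalized_costS.
have {}IH j' : best_cost i j' <= penalized_cost i j' x.
  by apply: IH => l lt_l; apply: ok; apply: ltnW.
apply: le_trans (_ : best_cost i (j - x i)%N + amount_cost i (x i) <= _); last first.
  by rewrite lerD2r.
rewrite /amount_cost; have [-> | nz] := eqVneq (x i) 0%N.
  by rewrite subn0 addr0; apply: scan_le0.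
case: (ok i (ltnSn i)) => [x0 | x_in]; first by rewrite x0 in nz.
have := @scan_le (best_cost i) i j (option_count i) (x i - q * mi i)%N.
by rewrite subnKC; [apply; rewrite /option_count; lia | lia].
Qed.

Lemma best_plan_allowed i j l : (l < i)%N -> allowed l (best_plan i j l).
Proof.
elim: i j => //= i IH j; rewrite ltnS leq_eqVlt.
have [-> _ | _ /= lt_l] := eqVneq l i; last exact: IH.
by have [] := @scan_attained (best_cost i) i j (option_count i) (leqnn _).
Qed.

Lemma penalized_cost_plan i j :
  penalized_cost i j (best_plan i j) <= best_cost i j.
Proof.
elim: i j => [|i IH] j; first by rewrite /penalized_cost !big_ord0 add0r leqn0.
rewrite penalized_costS [best_plan i.+1 j i]/= eqxx.
set a := best_amount i j.
have [_] := @scan_attained (best_cost i) i j (option_count i) (leqnn _).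
apply: le_trans; rewrite lerD2r; apply: le_trans (IH _).
rewrite le_eqVlt; apply/orP; left; apply/eqP.
have eq_plan (l : 'I_i) : best_plan i.+1 j l = best_plan i (j - a) l.
  by rewrite /= ltn_eqF.
rewrite /penalized_cost; congr (_ + _).
  by apply: eq_bigr => l _; rewrite eq_plan.
by rewrite (eq_bigr (fun l : 'I_i => best_plan i (j - a) l)) // => l _; rewrite eq_plan.
Qed.

End Grid.

(** The best value and vector found on the grids of steps [1 / c], ..., [1 / (c k)];
    the value is the penalty, and the vector irrelevant, if no vector on these
    grids has a penalized cost below the penalty. *)
Fixpoint best_solution (k : nat) : rat * (nat -> rat) :=
  if k is k'.+1 then
    let q := (c * k'.+1)%N in
    if best_cost q n (P * q) < (best_solution k').1
    then (best_cost q n (P * q), fun l => (best_plan q n (P * q) l)%:R / q%:R)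
    else best_solution k'
  else (penalty, fun=> 0).

Lemma best_solution_le k k' : (k' < k)%N ->
  (best_solution k).1 <= best_cost (c * k'.+1) n (P * (c * k'.+1)).
Proof.
elim: k => //= k IH; rewrite ltnS leq_eqVlt => /predU1P[-> | lt_k].
  by case: ltP.
by case: ifP => [/ltW lt|_]; [apply: le_trans lt _ |]; apply: IH.
Qed.

Lemma best_solution_attained k : (best_solution k).1 < penalty ->
  exists2 k', (k' < k)%N & let q := (c * k'.+1)%N in
    (best_solution k).1 = best_cost q n (P * q) /\
    forall l, (best_solution k).2 l = (best_plan q n (P * q) l)%:R / q%:R.
Proof.
elim: k => [|k IH] /=; first by rewrite ltxx.
case: ifP => [_ _ | _ /IH[k' lt_k Hk']]; first by exists k.
by exists k' => //; apply: ltnW.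
Qed.

End Recursion.

(** * The program *)

(** Registers: the input data, the penalty, the best value so far, the index and
    the inverse step of the current grid, the length of the rows of the tables,
    the current supplier, residual demand, amount and value. Arrays: the input
    data, the tables of least costs and of amounts, stored row by row, and the
    best vector so far. *)
Local Notation r_n := 0%N (only parsing).
Local Notation r_P := 1%N (only parsing).
Local Notation r_la := 2%N (only parsing).
Local Notation r_c := 3%N (only parsing).
Local Notation r_penalty := 4%N (only parsing).
Local Notation r_best := 5%N (only parsing).
Local Notation r_k := 6%N (only parsing).
Local Notation r_q := 7%N (only parsing).
Local Notation r_width := 8%N (only parsing).
Local Notation r_i := 9%N (only parsing).
Local Notation r_j := 10%N (only parsing).
Local Notation r_a := 11%N (only parsing).
Local Notation r_v := 12%N (only parsing).
Local Notation a_al := 0%N (only parsing).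
Local Notation a_be := 1%N (only parsing).
Local Notation a_mi := 2%N (only parsing).
Local Notation a_ma := 3%N (only parsing).
Local Notation a_cost := 4%N (only parsing).
Local Notation a_amount := 5%N (only parsing).
Local Notation a_sol := 6%N (only parsing).

Declare Scope prog_scope.
Local Notation "e1 + e2" := (Op Add e1 e2) : prog_scope.
Local Notation "e1 - e2" := (Op Defs.Sub e1 e2) : prog_scope.
Local Notation "e1 * e2" := (Op Mul e1 e2) : prog_scope.
Local Notation "e1 / e2" := (Op Div e1 e2) : prog_scope.
Local Notation "e1 <= e2" := (Test Le e1 e2) : prog_scope.
Local Notation "e1 < e2" := (Test Lt e1 e2) : prog_scope.
Local Notation "'$' r" := (Reg r) (at level 1, format "'$' r") : prog_scope.
Local Notation "'#' z" := (Const z) (at level 1, format "'#' z") : prog_scope.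
Local Notation "r ::= e" := (SetReg r e) (at level 80, e at level 70) : prog_scope.
Local Notation "p ;; p'" := (Seq p p') (at level 90, right associativity) : prog_scope.

Local Open Scope prog_scope.

(** The expression for the cost of a delivery [e] from the current supplier. *)
Definition cost_expr (e : expr) : expr :=
  (Cell a_al $r_i + Cell a_be $r_i * e) + ($r_c * (e * e)) / (#2 * $r_la).

Definition penalty_prog : program :=
  r_penalty ::= #1 ;; r_i ::= #0 ;;
  While ($r_i < $r_n)
    (r_penalty ::= $r_penalty + cost_expr (Cell a_ma $r_i) ;;
     r_i ::= $r_i + #1).

(** Index of column [e] in the row of the current supplier, and in the next row. *)
Definition here (e : expr) : expr := $r_i * $r_width + e.
Definition below (e : expr) : expr := ($r_i + #1) * $r_width + e.

(** One entry of the tables. *)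
Definition scan_prog : program :=
  SetCell a_cost (below $r_j) (Cell a_cost (here $r_j)) ;;
  SetCell a_amount (here $r_j) #0 ;;
  r_a ::= $r_q * Cell a_mi $r_i ;;
  While ($r_a <= $r_q * Cell a_ma $r_i)
    (If ($r_a <= $r_j)
       (r_v ::= Cell a_cost (here ($r_j - $r_a)))
       (r_v ::= Cell a_cost (here #0)) ;;
     r_v ::= $r_v + cost_expr ($r_a / $r_q) ;;
     If ($r_v < Cell a_cost (below $r_j))
       (SetCell a_cost (below $r_j) $r_v ;; SetCell a_amount (here $r_j) $r_a)
       Skip ;;
     r_a ::= $r_a + #1).

(** One row of the tables. *)
Definition row_prog : program :=
  r_j ::= #0 ;;
  While ($r_j < $r_width) (scan_prog ;; r_j ::= $r_j + #1).

Definition first_row_prog : program :=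
  r_j ::= #0 ;;
  While ($r_j < $r_width)
    (SetCell a_cost $r_j $r_penalty ;; r_j ::= $r_j + #1) ;;
  SetCell a_cost #0 #0.

Definition table_prog : program :=
  first_row_prog ;;
  r_i ::= #0 ;;
  While ($r_i < $r_n) (row_prog ;; r_i ::= $r_i + #1).

(** Reads an optimal vector off the table of amounts, from the last supplier to
    the first. *)
Definition plan_prog : program :=
  r_j ::= $r_width - #1 ;;
  r_i ::= $r_n ;;
  While (#0 < $r_i)
    (r_i ::= $r_i - #1 ;;
     r_a ::= Cell a_amount (here $r_j) ;;
     SetCell a_sol $r_i ($r_a / $r_q) ;;
     If ($r_a <= $r_j) (r_j ::= $r_j - $r_a) (r_j ::= #0)).

(** The optimum on the current grid. *)
Definition last_cell : expr := Cell a_cost ($r_n * $r_width + ($r_width - #1)).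

(** Dynamic programming on the next grid. *)
Definition grid_prog : program :=
  r_k ::= $r_k + #1 ;;
  r_q ::= $r_c * $r_k ;;
  r_width ::= $r_P * $r_q + #1 ;;
  table_prog ;;
  If (last_cell < $r_best) (r_best ::= last_cell ;; plan_prog) Skip.

Definition copy_prog : program :=
  r_i ::= #0 ;;
  While ($r_i < $r_n) (SetCell 0 $r_i (Cell a_sol $r_i) ;; r_i ::= $r_i + #1).

Definition solver : program :=
  penalty_prog ;;
  r_best ::= $r_penalty ;;
  r_k ::= #0 ;;
  While ($r_k < $r_n) grid_prog ;;
  copy_prog ;;
  1%N ::= $r_best ;;
  If ($r_best < $r_penalty) (0%N ::= #1) (0%N ::= #0).

Close Scope prog_scope.

(** * Correctness and running time of the program *)

Section Correctness.
Variables (n P la c : nat) (al be mi ma : nat -> nat).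
Hypotheses (n_gt0 : (0 < n)%N) (P_gt0 : (0 < P)%N).
Hypotheses (la_gt0 : (0 < la)%N) (c_gt0 : (0 < c)%N).
Hypothesis le_mima : forall i, (mi i <= ma i)%N.

Let cost := active_cost la c al be.

(** The registers and arrays of the input hold the input data. *)
Definition has_input (s : store) : Prop :=
  [/\ reg s r_n = n%:R, reg s r_P = P%:R, reg s r_la = la%:R & reg s r_c = c%:R] /\
  [/\ arr s a_al =1 (fun i => (al i)%:R), arr s a_be =1 (fun i => (be i)%:R),
      arr s a_mi =1 (fun i => (mi i)%:R) & arr s a_ma =1 (fun i => (ma i)%:R)].

Lemma has_input_agree p s s' :
  all (leq 4) (written_regs p) -> all (leq 4) (written_arrs p) ->
  agree p s s' -> has_input s -> has_input s'.
Proof.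
move=> /allP wr /allP wa [ar aa].
have in_r r : (r < 4)%N -> reg s' r = reg s r.
  by move=> lt_r; apply/ar/negP => /wr; rewrite leqNgt lt_r.
have in_a a : (a < 4)%N -> arr s' a = arr s a.
  by move=> lt_a; apply/aa/negP => /wa; rewrite leqNgt lt_a.
by rewrite /has_input !in_r ?in_a.
Qed.

Lemma eval_cost s e i v : has_input s -> reg s r_i = i%:R -> eval s e = Some v ->
  eval s (cost_expr e) = Some (cost i v).
Proof.
move=> [[_ _ s_la s_c] [s_al s_be _ _]] s_i ev; rewrite /cost /active_cost.
have ei : eval s (Reg r_i) = Some i%:R by rewrite /= s_i.
apply: eval_add; first apply: eval_add.
- by rewrite (eval_cell _ ei) s_al.
- by apply: eval_mul => //; rewrite (eval_cell _ ei) s_be.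
apply: eval_div; first by rewrite mulf_neq0 // pnatr_eq0 -lt0n.
  by apply: eval_mul; [rewrite /= s_c | apply: eval_mul].
by apply: eval_mul; rewrite /= ?s_la.
Qed.

Lemma penalty_prog_runs s : has_input s ->
  runs penalty_prog s (60 * n + 60)
    (fun s' => reg s' r_penalty = penalty n la c al be ma).
Proof.
move=> inp; apply: runs_le.
  apply: runs_seq; apply: runs_reg => //; apply: runs_seq; apply: runs_reg => //.
  apply: (@runs_while _ _ _ n (fun=> 40%N) (fun i s' =>
    reg s' r_i = i%:R /\ reg s' r_penalty = 1 + \sum_(l < i) cost l (ma l)%:R)).
  - by rewrite /= big_ord0 addr0.
  - move=> i s' lt_i ag [s_i s_pen].
    have inp' : has_input s' by exact: (has_input_agree _ _ ag inp).
    case: (inp') => [[s_n _ _ _] [_ _ _ s_ma]].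
    split; first by rewrite /= s_i s_n ltr_nat lt_i.
    apply: runs_le.
      apply: runs_seq; apply: runs_reg.
        apply: eval_add; first by rewrite /= s_pen.
        apply: (eval_cost inp' s_i).
        by rewrite (@eval_cell _ _ _ i) ?s_ma //= s_i.
      apply: runs_reg; first by apply: (@eval_addn _ _ _ i 1); rewrite //= s_i.
      by split; rewrite /= ?addn1 ?big_ord_recr /= ?addrA.
    by [].
  - move=> s' ag [s_i s_pen]; split=> //.
    have [[s_n _ _ _] _] : has_input s' by exact: (has_input_agree _ _ ag inp).
    by rewrite /= s_i s_n ltxx.
by rewrite sum_nat_const card_ord /=; lia.
Qed.

Section Grid.
Variable q : nat.
Hypothesis q_gt0 : (0 < q)%N.

Let width := (P * q).+1.
Let row := best_cost n la c al be mi ma q.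
Let amount := best_amount n la c al be mi ma q.
Let scanr := scan la c al be mi q.
Let options := option_count mi ma q.

(** In addition, the penalty and the parameters of the grid have been set. *)
Definition has_grid (s : store) : Prop :=
  [/\ has_input s, reg s r_penalty = penalty n la c al be ma,
      reg s r_q = q%:R & reg s r_width = width%:R].

Lemma has_grid_agree p s s' :
  all (fun r => (4 < r)%N && (r \notin [:: r_q; r_width])) (written_regs p) ->
  all (leq 4) (written_arrs p) ->
  agree p s s' -> has_grid s -> has_grid s'.
Proof.
move=> wr wa ag [inp s_pen s_q s_width].
have out r : r \in [:: r_penalty; r_q; r_width] -> reg s' r = reg s r.
  move=> r_in; apply: ag.1; apply/negP => /(allP wr).
  by move: r_in; rewrite !inE => /or3P[] /eqP ->.
split; rewrite ?out //.
by apply: has_input_agree ag inp => //; apply: sub_all wr => r /andP[/ltnW].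
Qed.

Lemma eval_here s e i j : has_grid s -> reg s r_i = i%:R -> eval s e = Some j%:R ->
  eval s (here e) = Some (i * width + j)%:R.
Proof.
move=> [_ _ _ s_width] s_i ev; apply: eval_addn => //; apply: eval_muln.
  by rewrite /= s_i.
by rewrite /= s_width.
Qed.

Lemma eval_below s e i j : has_grid s -> reg s r_i = i%:R -> eval s e = Some j%:R ->
  eval s (below e) = Some (i.+1 * width + j)%:R.
Proof.
move=> [_ _ _ s_width] s_i ev; apply: eval_addn => //; apply: eval_muln.
  by rewrite -[i.+1]addn1; apply: eval_addn; rewrite /= ?s_i.
by rewrite /= s_width.
Qed.

(** Each of the two tables changes in a single entry. *)
Lemma scan_prog_runs s i j (f : nat -> rat) : has_grid s ->
  reg s r_i = i%:R -> reg s r_j = j%:R -> (j < width)%N ->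
  (forall l, (l <= j)%N -> arr s a_cost (i * width + l) = f l) ->
  runs scan_prog s (150 * options i + 60) (fun s' =>
    (forall l, arr s' a_cost l = if l == (i.+1 * width + j)%N
       then (scanr f i j (options i)).1 else arr s a_cost l) /\
    (forall l, arr s' a_amount l = if l == (i * width + j)%N
       then (scanr f i j (options i)).2%:R else arr s a_amount l)).
Proof.
move=> grid s_i s_j lt_j s_f.
have q0 : q%:R != 0 :> rat by rewrite pnatr_eq0 -lt0n.
have idx_neq l : (l <= j)%N -> ((i * width + l)%N == (i.+1 * width + j)%N) = false.
  by move=> le_l; rewrite mulSn; lia.
case: (grid) => [[inp1 [s_al s_be s_mi s_ma]] _ s_q s_width].
apply: runs_le.
  apply: runs_seq; apply: runs_cell.
  - by apply: (@eval_below _ _ i j) => //; rewrite /= s_j.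
  - apply: (@eval_cell _ _ _ (i * width + j)); apply: eval_here => //.
    by rewrite /= s_j.
  apply: runs_seq; apply: runs_cell.
  - by apply: (@eval_here _ _ i j) => //; rewrite /= s_j.
  - by [].
  apply: runs_seq; apply: runs_reg.
    apply: eval_muln; first by rewrite /= s_q.
    by rewrite (@eval_cell _ _ _ i) /= ?s_mi ?s_i.
  set s1 := set_reg _ _ _.
  have grid1 : has_grid s1 by [].
  apply: (@runs_while _ _ _ (options i) (fun=> 100%N) (fun t s' =>
    [/\ reg s' r_a = (q * mi i + t)%:R,
     forall l, arr s' a_cost l = if l == (i.+1 * width + j)%N
       then (scanr f i j t).1 else arr s a_cost l &
     forall l, arr s' a_amount l = if l == (i * width + j)%N
       then (scanr f i j t).2%:R else arr s a_amount l])).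
  - by rewrite addn0; split=> //= l; case: eqP => // _; rewrite s_f.
  - move=> t s' lt_t ag [s'_a s'_cost s'_amount].
    have grid' : has_grid s' by exact: (has_grid_agree _ _ ag grid1).
    have s'_i : reg s' r_i = i%:R by rewrite ag.1.
    have s'_j : reg s' r_j = j%:R by rewrite ag.1.
    case: (grid') => [[inp' [_ _ _ s'_ma]] _ s'_q _].
    split.
      rewrite (@eval_leq _ _ _ (q * mi i + t) (q * ma i)); last first.
      - apply: eval_muln; first by rewrite /= s'_q.
        by rewrite (@eval_cell _ _ _ i) /= ?s'_ma ?s'_i.
      - by rewrite /= s'_a.
      have : (q * mi i <= q * ma i)%N by rewrite leq_mul2l le_mima orbT.
      by move=> le_q; congr Some; move: lt_t; rewrite /options /option_count; lia.
    set a := (q * mi i + t)%N in s'_a *.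
    pose v := f (j - a)%N + cost i (a%:R / q%:R).
    apply: runs_le.
      apply: (@runs_seq_eq _ _ _ (set_reg s' r_v (f (j - a)%N))).
        apply: (@runs_if _ (a <= j)%N).
        + by apply: eval_leq; rewrite /= ?s'_a ?s'_j.
        + move=> le_a; apply: runs_reg => //.
          rewrite (@eval_cell _ _ _ (i * width + (j - a))).
            by rewrite s'_cost idx_neq ?leq_subr // s_f ?leq_subr.
          by apply: eval_here => //; apply: eval_subn; rewrite //= ?s'_a ?s'_j.
        + rewrite -ltnNge => lt_a; apply: runs_reg => //.
          rewrite (@eval_cell _ _ _ (i * width + 0)).
            rewrite s'_cost idx_neq // s_f //.
            by have /eqP -> : (j - a == 0)%N by rewrite subn_eq0 ltnW.
          exact: eval_here.
      have grid2 : has_grid (set_reg s' r_v (f (j - a)%N)) by [].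
      apply: runs_seq; apply: (@runs_reg _ _ _ v).
        apply: eval_add; first by [].
        apply: eval_cost; [by case: grid2 | by [] |].
        by apply: eval_div => //=; rewrite ?s'_a ?s'_q.
      apply: runs_seq.
      set s3 := set_reg _ _ _.
      have grid3 : has_grid s3 by [].
      have s3_j : eval s3 (Reg r_j) = Some j%:R by rewrite /= s'_j.
      apply: (@runs_if _ (v < (scanr f i j t).1)) => [|lt_v|].
      - apply: eval_lt; first by [].
        by rewrite (@eval_cell _ _ _ (i.+1 * width + j)) ?(eval_below grid3 s'_i s3_j)
          //= s'_cost eqxx.
      - apply: runs_seq; apply: runs_cell; [exact: (eval_below grid3 s'_i s3_j) | by [] |].
        apply: runs_cell; [| by [] |].
          by apply: eval_here; [exact: grid3 | exact: s'_i | exact: s3_j].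
        apply: runs_reg; first by apply: (@eval_addn _ _ _ a 1); rewrite //= s'_a.
        rewrite /= -/scanr lt_v; split=> /= [|l|l].
        + by rewrite addn1 addnS.
        + by rewrite s'_cost; case: eqP.
        + by rewrite s'_amount s'_a; case: eqP.
      - move=> /negbTE ge_v; apply: runs_skip.
        apply: runs_reg; first by apply: (@eval_addn _ _ _ a 1); rewrite //= s'_a.
        by rewrite /= -/scanr ge_v; split=> //=; rewrite addn1 addnS.
    by [].
  - move=> s' ag [s'_a s'_cost s'_amount]; split=> //.
    have [[_ [_ _ _ s'_ma]] _ s'_q _] : has_grid s'.
      by exact: (has_grid_agree _ _ ag grid1).
    have s'_i : reg s' r_i = i%:R by rewrite ag.1.
    rewrite (@eval_leq _ _ _ (q * mi i + options i) (q * ma i)); last first.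
    - apply: eval_muln; first by rewrite /= s'_q.
      by rewrite (@eval_cell _ _ _ i) /= ?s'_ma ?s'_i.
    - by rewrite /= s'_a.
    have : (q * mi i <= q * ma i)%N by rewrite leq_mul2l le_mima orbT.
    by move=> le_q; congr Some; rewrite /options /option_count; lia.
by rewrite sum_nat_const card_ord /=; lia.
Qed.

(** The entries that precede column [j] of row [i.+1] in the table of costs,
    and column [j] of row [i] in the table of amounts, have been computed. *)
Definition filled (i j : nat) (s : store) : Prop :=
  (forall l, (l < i.+1 * width + j)%N ->
     arr s a_cost l = row (l %/ width) (l %% width)) /\
  (forall l, (l < i * width + j)%N ->
     arr s a_amount l = (amount (l %/ width) (l %% width))%:R).

Lemma filled_cost i j s i' j' : filled i j s -> (i' <= i)%N -> (j' < width)%N ->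
  arr s a_cost (i' * width + j')%N = row i' j'.
Proof.
move=> [fill _] le_i lt_j; rewrite fill; last first.
  have : (i' * width <= i * width)%N by rewrite leq_mul2r le_i orbT.
  by rewrite mulSn; lia.
by rewrite divnMDl // modnMDl modn_small // divn_small // addn0.
Qed.

Lemma filled_amount i s i' j' : filled i 0 s -> (i' < i)%N -> (j' < width)%N ->
  arr s a_amount (i' * width + j')%N = (amount i' j')%:R.
Proof.
move=> [_ fill] lt_i lt_j; rewrite fill; last first.
  have : (i'.+1 * width <= i * width)%N by rewrite leq_mul2r lt_i orbT.
  by rewrite mulSn; lia.
by rewrite divnMDl // modnMDl modn_small // divn_small // addn0.
Qed.

Lemma row_prog_runs s i : has_grid s -> reg s r_i = i%:R -> filled i 0 s ->
  runs row_prog s (300 * width * options i + 60) (filled i.+1 0).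
Proof.
move=> grid s_i fill; apply: runs_le.
  apply: runs_seq; apply: runs_reg => //.
  set s1 := set_reg _ _ _; have grid1 : has_grid s1 by [].
  apply: (@runs_while _ _ _ width (fun=> 150 * options i + 70)%N (fun j s' =>
    reg s' r_j = j%:R /\ filled i j s')) => //.
  - move=> j s' lt_j ag [s'_j fill'].
    have grid' : has_grid s' by exact: (has_grid_agree _ _ ag grid1).
    have s'_i : reg s' r_i = i%:R by rewrite ag.1.
    have [_ _ _ s'_width] := grid'.
    split; first by rewrite (eval_ltn (i := j) (j := width)) ?lt_j //= ?s'_j ?s'_width.
    apply: runs_le.
      apply: runs_seq.
      apply: runs_conseq (@scan_prog_runs s' i j (row i) grid' s'_i s'_j lt_j _) (leqnn _) _.
        by move=> l le_l; rewrite (filled_cost fill') // (leq_ltn_trans le_l).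
      move=> s2 ag2 [cost2 amount2]; apply: runs_reg.
        by apply: (@eval_addn _ _ _ j 1); rewrite //= ag2.1 //= s'_j.
      rewrite /= addn1; split=> //; case: fill' => fc fa.
      split=> l /=; rewrite addnS ltnS leq_eqVlt => /predU1P[-> | lt_l].
      + rewrite cost2 eqxx divnMDl // modnMDl modn_small // divn_small //.
        by rewrite addn0.
      + by rewrite cost2 ltn_eqF // fc.
      + rewrite amount2 eqxx divnMDl // modnMDl modn_small // divn_small //.
        by rewrite addn0.
      + by rewrite amount2 ltn_eqF // fa.
    by rewrite /=; lia.
  - move=> s' ag [s'_j [fc fa]].
    have [_ _ _ s'_width] : has_grid s' by exact: (has_grid_agree _ _ ag grid1).
    split; first by rewrite (eval_ltn (i := width) (j := width)) ?ltnn //= ?s'_j ?s'_width.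
    by split=> l; rewrite mulSn addnAC addn0 [(width + _)%N]addnC; [apply: fc | apply: fa].
have : (0 < options i)%N by [].
by rewrite sum_nat_const card_ord /=; nia.
Qed.

Lemma first_row_prog_runs s : has_grid s ->
  runs first_row_prog s (20 * width + 20) (filled 0 0).
Proof.
move=> grid; apply: runs_le.
  apply: runs_seq; apply: runs_reg => //.
  apply: runs_seq.
  set s1 := set_reg _ _ _; have grid1 : has_grid s1 by [].
  apply: (@runs_while _ _ _ width (fun=> 10%N) (fun j s' => reg s' r_j = j%:R /\
    forall l, (l < j)%N -> arr s' a_cost l = penalty n la c al be ma)) => //.
  - move=> j s' lt_j ag [s'_j fill].
    have [_ s'_pen _ s'_width] : has_grid s' by exact: (has_grid_agree _ _ ag grid1).
    split; first by rewrite (eval_ltn (i := j) (j := width)) ?lt_j //= ?s'_j ?s'_width.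
    apply: runs_le.
      apply: runs_seq; apply: (runs_cell (i := j)); rewrite /= ?s'_j ?s'_pen //.
      apply: runs_reg; first by apply: (@eval_addn _ _ _ j 1); rewrite //= s'_j.
      rewrite /= addn1; split=> // l; rewrite ltnS leq_eqVlt => /predU1P[-> | lt_l].
        by rewrite eqxx.
      by rewrite ltn_eqF // fill.
    by [].
  - move=> s' ag [s'_j fill].
    have [_ _ _ s'_width] : has_grid s' by exact: (has_grid_agree _ _ ag grid1).
    split; first by rewrite (eval_ltn (i := width) (j := width)) ?ltnn //= ?s'_j ?s'_width.
    apply: (runs_cell (i := 0)) => //; split=> //= l; rewrite mul1n addn0 => lt_l.
    by rewrite divn_small // modn_small //=; case: eqP => // _; apply: fill.
by rewrite sum_nat_const card_ord /=; lia.
Qed.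

Lemma table_prog_runs s : has_grid s ->
  runs table_prog s (600 * width * \sum_(i < n) options i + 60) (filled n 0).
Proof.
move=> grid; apply: runs_le.
  apply: runs_seq; apply: runs_conseq (first_row_prog_runs grid) (leqnn _) _.
  move=> s0 ag0 fill0.
  have grid0 : has_grid s0 by exact: (has_grid_agree _ _ ag0 grid).
  apply: runs_seq; apply: runs_reg => //.
  set s1 := set_reg _ _ _; have grid1 : has_grid s1 by [].
  apply: (@runs_while _ _ _ n (fun i => 300 * width * options i + 70)%N (fun i s' =>
    reg s' r_i = i%:R /\ filled i 0 s')) => //.
  - move=> i s' lt_i ag [s'_i fill'].
    have grid' : has_grid s' by exact: (has_grid_agree _ _ ag grid1).
    have [[[s'_n _ _ _] _] _ _ _] := grid'.
    split; first by rewrite (eval_ltn (i := i) (j := n)) ?lt_i //= ?s'_i ?s'_n.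
    apply: runs_le.
      apply: runs_seq; apply: runs_conseq (row_prog_runs grid' s'_i fill') (leqnn _) _.
      move=> s2 ag2 fill2; apply: runs_reg.
        by apply: (@eval_addn _ _ _ i 1); rewrite //= ag2.1 //= s'_i.
      by rewrite /= addn1.
    by rewrite /=; lia.
  - move=> s' ag [s'_i fill']; split=> //.
    have [[[s'_n _ _ _] _] _ _ _] : has_grid s' by exact: (has_grid_agree _ _ ag grid1).
    by rewrite (eval_ltn (i := n) (j := n)) ?ltnn //= ?s'_i ?s'_n.
have le_n : (n <= \sum_(i < n) options i)%N.
  rewrite -[leqLHS]card_ord -sum1_card; exact: leq_sum.
rewrite big_split big_split /= !sum_nat_const card_ord -big_distrr /=.
set S := (\sum_(i < n) _)%N in le_n *.
have : (n * width <= S * width)%N by rewrite leq_mul2r le_n orbT.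
have : (width <= n * width)%N by rewrite leq_pmull.
have : (n <= n * width)%N by rewrite leq_pmulr.
by rewrite [(S * width)%N]mulnC -[(600 * _ * _)%N]mulnA -[(300 * _ * _)%N]mulnA; lia.
Qed.

Lemma plan_prog_runs s : has_grid s -> filled n 0 s ->
  runs plan_prog s (60 * n + 30) (fun s' => forall l, (l < n)%N ->
    arr s' a_sol l
      = (best_plan n la c al be mi ma q n (P * q) l)%:R / q%:R).
Proof.
move=> grid fill; apply: runs_le.
  have [[[s_n _ _ _] _] _ _ s_width] := grid.
  apply: runs_seq; apply: runs_reg.
    apply: (@eval_subn _ _ _ width 1); by rewrite //= s_width.
  rewrite subn1 /=; apply: runs_seq; apply: runs_reg; first by rewrite /= s_n.
  set s1 := set_reg _ _ _.
  have grid1 : has_grid s1 by [].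
  have fill1 : filled n 0 s1 by [].
  apply: (@runs_while _ _ _ n (fun=> 50%N) (fun d s' => exists j,
    [/\ (j < width)%N, reg s' r_j = j%:R, reg s' r_i = (n - d)%:R,
      forall l, (l < n - d)%N -> best_plan n la c al be mi ma q n (P * q) l
        = best_plan n la c al be mi ma q (n - d) j l &
      forall l, (n - d <= l < n)%N -> arr s' a_sol l
        = (best_plan n la c al be mi ma q n (P * q) l)%:R / q%:R])).
  - exists (P * q)%N; rewrite subn0; split=> //= l; by case: ltngtP.
  - move=> d s' lt_d ag [j [lt_j s'_j s'_i plan' sol']].
    have grid' : has_grid s' by exact: (has_grid_agree _ _ ag grid1).
    have fill' : filled n 0 s' by rewrite /filled !ag.2.
    have [i eq_i] : {i | (n - d = i.+1)%N} by exists (n - d).-1; lia.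
    have eq_i' : (n - d.+1 = i)%N by lia.
    rewrite eq_i in s'_i plan' sol'; rewrite eq_i'.
    split; first by rewrite (eval_ltn (i := 0) (j := i.+1)) //= s'_i.
    have next s3 : reg s3 r_j = (j - amount i j)%:R -> reg s3 r_i = i%:R ->
        (forall l, arr s3 a_sol l
           = if l == i then (amount i j)%:R / q%:R else arr s' a_sol l) ->
        exists j0,
        [/\ (j0 < width)%N, reg s3 r_j = j0%:R, reg s3 r_i = i%:R,
          forall l, (l < i)%N -> best_plan n la c al be mi ma q n (P * q) l
            = best_plan n la c al be mi ma q i j0 l &
          forall l, (i <= l < n)%N -> arr s3 a_sol l
            = (best_plan n la c al be mi ma q n (P * q) l)%:R / q%:R].
      move=> s3_j s3_i s3_sol; exists (j - amount i j)%N; split=> //.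
      - exact: leq_ltn_trans (leq_subr _ _) lt_j.
      - by move=> l lt_l; rewrite plan' 1?ltnW //= ltn_eqF.
      - move=> l /andP[le_l lt_l]; rewrite s3_sol; case: eqP => [-> | /eqP ne_l].
          by rewrite plan' //= eqxx.
        by rewrite sol' // lt_l andbT ltn_neqAle eq_sym ne_l.
    have q0 : q%:R != 0 :> rat by rewrite pnatr_eq0 -lt0n.
    apply: runs_le.
      apply: runs_seq; apply: runs_reg.
        by apply: (@eval_subn _ _ _ i.+1 1); rewrite //= s'_i.
      rewrite subn1 /=; set s2 := set_reg _ _ _.
      have grid2 : has_grid s2 by [].
      have s2_i : reg s2 r_i = i%:R by [].
      have s2_j : reg s2 r_j = j%:R by [].
      apply: runs_seq; apply: (runs_reg (v := (amount i j)%:R)).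
        rewrite (@eval_cell _ _ _ (i * width + j)); last first.
          by apply: eval_here => //; rewrite /= s'_j.
        by congr Some; apply: (filled_amount fill') => //; lia.
      have [_ _ s'_q _] := grid'.
      apply: runs_seq; apply: (runs_cell (i := i) (v := (amount i j)%:R / q%:R)).
      - by [].
      - by apply: eval_div => //=; rewrite ?s'_q.
      apply: (@runs_if _ (amount i j <= j)%N).
      - by apply: eval_leq; rewrite /= ?s'_j.
      - move=> le_a; apply: runs_reg.
          by apply: (eval_subn le_a); rewrite //= s'_j.
        by apply: next.
      - rewrite -ltnNge => lt_a; apply: runs_reg; first by [].
        apply: next => //=; congr _%:R.
        by apply/esym/eqP; rewrite subn_eq0 ltnW.
    by [].
  - move=> s' ag [j [_ _ s'_i _ sol']]; rewrite subnn in s'_i sol'; split=> //.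
    by rewrite (eval_ltn (i := 0) (j := 0)) //= s'_i.
by rewrite sum_nat_const card_ord /=; lia.
Qed.

End Grid.

Let best := best_solution n P la c al be mi ma.
Let pen := penalty n la c al be ma.

(** The best value over the first [k] grids has been found, and so has the best
    vector if this value is below the penalty. *)
Definition found (k : nat) (s : store) : Prop :=
  [/\ has_input s, reg s r_penalty = pen, reg s r_k = k%:R,
      reg s r_best = (best k).1 &
      (best k).1 < pen -> forall l, (l < n)%N -> arr s a_sol l = (best k).2 l].

(** A bound on the number of operations of [grid_prog] for the inverse step [q]. *)
Definition grid_time (q : nat) : nat :=
  (600 * (P * q).+1 * \sum_(i < n) option_count mi ma q i + 60 * n + 300)%N.

Lemma grid_prog_runs s k : found k s ->
  runs grid_prog s (grid_time (c * k.+1)) (found k.+1).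
Proof.
move=> [inp s_pen s_k s_best s_sol]; apply: runs_le.
  have [[s_n s_P _ s_c] _] := inp.
  set q := (c * k.+1)%N.
  have q_gt0 : (0 < q)%N by rewrite muln_gt0 c_gt0.
  apply: runs_seq; apply: (runs_reg (v := k.+1%:R)).
    by rewrite -[k.+1]addn1; apply: eval_addn; rewrite //= s_k.
  apply: runs_seq; apply: (runs_reg (v := q%:R)).
    by apply: eval_muln; rewrite //= s_c.
  apply: runs_seq; apply: (runs_reg (v := (P * q).+1%:R)).
    rewrite -[(P * q).+1]addn1; apply: eval_addn => //.
    by apply: eval_muln; rewrite //= s_P.
  set s1 := set_reg _ _ _.
  have grid1 : has_grid q s1 by [].
  apply: runs_seq; apply: runs_conseq (table_prog_runs q_gt0 grid1) (leqnn _) _.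
  move=> s2 ag2 fill2.
  have grid2 : has_grid q s2 by exact: (has_grid_agree _ _ ag2 grid1).
  have s2_k : reg s2 r_k = k.+1%:R by rewrite ag2.1.
  have s2_best : reg s2 r_best = (best k).1 by rewrite ag2.1.
  have s2_sol : arr s2 a_sol = arr s a_sol by rewrite ag2.2.
  set v := best_cost n la c al be mi ma q n (P * q).
  have ev : eval s2 last_cell = Some v.
    have [[[s2_n _ _ _] _] _ _ s2_width] := grid2.
    rewrite (@eval_cell _ _ _ (n * (P * q).+1 + ((P * q).+1 - 1))).
      by rewrite subn1 (filled_cost q_gt0 fill2).
    apply: eval_addn; first by apply: eval_muln; rewrite /= ?s2_n ?s2_width.
    by apply: eval_subn; rewrite //= s2_width.
  apply: (@runs_if _ (v < (best k).1)).
  - by apply: eval_lt ev _; rewrite /= s2_best.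
  - move=> lt_v; apply: runs_seq; apply: (runs_reg ev).
    have grid3 : has_grid q (set_reg s2 r_best v) by [].
    apply: runs_conseq (plan_prog_runs q_gt0 grid3 fill2) (leqnn _) _.
    move=> s4 ag4 sol4.
    have [inp4 pen4 _ _] : has_grid q s4 by exact: (has_grid_agree _ _ ag4 grid3).
    split=> //; rewrite ?ag4.1 //= -/q -/v lt_v //.
  - move=> /negbTE ge_v; apply: runs_skip; have [inp2 pen2 _ _] := grid2.
    split=> //; rewrite /= -/q -/v ge_v // => lt_best l lt_l.
    by rewrite s2_sol s_sol.
by rewrite /grid_time /=; lia.
Qed.

Lemma solver_runs s : has_input s ->
  runs solver s (80 * n + 200 + \sum_(k < n) (3 + grid_time (c * k.+1))) (fun s' =>
    [/\ reg s' 0%N = ((best n).1 < pen)%R%:R, reg s' 1%N = (best n).1 &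
      (best n).1 < pen -> forall l, (l < n)%N -> arr s' 0%N l = (best n).2 l]).
Proof.
move=> inp; apply: runs_le.
  apply: runs_seq; apply: runs_conseq (penalty_prog_runs inp) (leqnn _) _.
  move=> s1 ag1 pen1.
  have inp1 : has_input s1 by exact: (has_input_agree _ _ ag1 inp).
  apply: runs_seq; apply: (runs_reg (v := pen)); first by rewrite /= pen1.
  apply: runs_seq; apply: runs_reg => //.
  set s2 := set_reg _ _ _.
  have inp2 : has_input s2 by [].
  have found2 : found 0 s2 by split=> //=; rewrite ltxx.
  apply: runs_seq.
  apply: (@runs_while _ _ _ n (fun k => grid_time (c * k.+1)) found) => //.
    move=> k s3 lt_k ag3 found3; split; last exact: grid_prog_runs.
    have [[[s3_n _ _ _] _] _ s3_k _ _] := found3.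
    by rewrite (eval_ltn (i := k) (j := n)) ?lt_k //= ?s3_k ?s3_n.
  move=> s3 ag3 [inp3 pen3 k3 best3 sol3]; have [[s3_n _ _ _] _] := inp3.
  split; first by rewrite (eval_ltn (i := n) (j := n)) ?ltnn //= ?k3 ?s3_n.
  apply: runs_seq; apply: runs_seq; apply: runs_reg => //.
  apply: (@runs_while _ _ _ n (fun=> 10%N) (fun i s' => reg s' r_i = i%:R /\
    ((best n).1 < pen -> forall l, (l < i)%N -> arr s' 0%N l = (best n).2 l))) => //.
    move=> i s' lt_i ag [s'_i s'_sol].
    have s'_n : reg s' r_n = n%:R by rewrite ag.1.
    split; first by rewrite (eval_ltn (i := i) (j := n)) ?lt_i //= ?s'_i ?s'_n.
    apply: runs_le.
      apply: runs_seq; apply: (runs_cell (i := i)); first by rewrite /= s'_i.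
        by apply: (@eval_cell _ _ _ i); rewrite /= s'_i.
      apply: runs_reg; first by apply: (@eval_addn _ _ _ i 1); rewrite //= s'_i.
      rewrite /= addn1; split=> // lt_best l; rewrite ltnS leq_eqVlt.
      move=> /predU1P[-> | lt_l]; first by rewrite eqxx ag.2 //= sol3.
      by rewrite ltn_eqF // s'_sol.
    by [].
  move=> s' ag [s'_i s'_sol].
  have s'_n : reg s' r_n = n%:R by rewrite ag.1.
  split; first by rewrite (eval_ltn (i := n) (j := n)) ?ltnn //= ?s'_i ?s'_n.
  have s'_best : reg s' r_best = (best n).1 by rewrite ag.1.
  have s'_pen : reg s' r_penalty = pen by rewrite ag.1.
  apply: runs_seq; apply: (runs_reg (v := (best n).1)); first by rewrite /= s'_best.
  apply: (@runs_if _ ((best n).1 < pen)).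
  - by apply: eval_lt; rewrite /= ?s'_best ?s'_pen.
  - by move=> lt_best; apply: runs_reg => //; rewrite lt_best; split=> //= _; apply: s'_sol.
  - by move=> /negbTE ge_best; apply: runs_reg => //; rewrite ge_best; split.
rewrite sum_nat_const card_ord.
rewrite (eq_bigr (fun k : 'I_n => 3 + grid_time (c * k.+1))%N) //=; lia.
Qed.

Lemma grid_time_le k : (k < n)%N ->
  (grid_time (c * k.+1) <=
     3000 * (P * n ^ 2 * c ^ 2 * maxn 1 (\sum_(i < n) (ma i - mi i))))%N.
Proof.
move=> lt_k; set D := (\sum_(i < n) _)%N.
have -> : grid_time (c * k.+1)
    = (600 * (P * (c * k.+1)).+1 * (c * k.+1 * D + n) + 60 * n + 300)%N.
  rewrite /grid_time; congr (_ * _ + _ + _)%N.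
  rewrite (eq_bigr (fun i : 'I_n => c * k.+1 * (ma i - mi i) + 1)%N) => [|i _].
    by rewrite big_split -big_distrr sum_nat_const card_ord muln1.
  by rewrite /option_count mulnBr addn1.
have le_q : (c * k.+1 <= c * n)%N by rewrite leq_mul2l lt_k orbT.
set M := maxn 1 D; have M_gt0 : (0 < M)%N by rewrite leq_maxl.
have le_D : (D <= M)%N by rewrite leq_maxr.
have le1 : ((P * (c * k.+1)).+1 <= 2 * (P * (c * n)))%N.
  have : (P * (c * k.+1) <= P * (c * n))%N by rewrite leq_mul2l le_q orbT.
  have : (0 < P * (c * n))%N by rewrite !muln_gt0 P_gt0 c_gt0.
  lia.
have le2 : (c * k.+1 * D + n <= 2 * (c * n * M))%N.
  have : (c * k.+1 * D <= c * n * M)%N by rewrite leq_mul.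
  have : (n <= c * n * M)%N by rewrite mulnAC leq_pmull // muln_gt0 c_gt0.
  lia.
have le3 := leq_mul le1 le2.
have eqT : (2 * (P * (c * n)) * (2 * (c * n * M)) = 4 * (P * n ^ 2 * c ^ 2 * M))%N.
  by ring.
rewrite eqT in le3.
have le4 : (n <= P * n ^ 2 * c ^ 2 * M)%N.
  rewrite (_ : _ * M = n * (P * n * c ^ 2 * M))%N; last by ring.
  by rewrite leq_pmulr // !muln_gt0 P_gt0 n_gt0 c_gt0.
rewrite -[(600 * _ * _)%N]mulnA; lia.
Qed.

Lemma solver_time_le :
  (80 * n + 200 + \sum_(k < n) (3 + grid_time (c * k.+1)) <=
     4000 * (P * n ^ 3 * c ^ 2 * maxn 1 (\sum_(i < n) (ma i - mi i))))%N.
Proof.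
set M := maxn _ _; have M_gt0 : (0 < M)%N by rewrite leq_maxl.
set T := (P * n ^ 2 * c ^ 2 * M)%N.
have T_gt0 : (0 < T)%N by rewrite !muln_gt0 P_gt0 n_gt0 c_gt0.
have -> : (P * n ^ 3 * c ^ 2 * M = n * T)%N by rewrite /T; ring.
apply: leq_trans (_ : 80 * n + 200 + \sum_(k < n) (3 + 3000 * T) <= _)%N.
  by rewrite leq_add2l leq_sum // => k _; rewrite leq_add2l grid_time_le.
rewrite sum_nat_const card_ord mulnDr.
have : (n <= n * T)%N by rewrite leq_pmulr.
by rewrite mulnCA; lia.
Qed.

End Correctness.

(** * Optimality among real vectors *)

(** Extension of a function on ['I_n] by zero. *)
Definition extend0 (n : nat) (f : 'I_n -> nat) (i : nat) : nat :=
  if insub i is Some j then f j else 0%N.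

Lemma extend0_ord n (f : 'I_n -> nat) (i : 'I_n) : extend0 f i = f i.
Proof. by rewrite /extend0 valK. Qed.

Section Optimality.
Variables (R : realType) (I : problem).

Local Notation n := (suppliers I).
Local Notation P := (demand I).
Local Notation la := (intensity I).
Local Notation c := (storage_cost I).
Let al := extend0 (@fixed_cost I).
Let be := extend0 (@unit_cost I).
Let mi := extend0 (@min_volume I).
Let ma := extend0 (@max_volume I).

Local Notation pen := (penalty n la c al be ma).
Local Notation best := (best_solution n P la c al be mi ma n).

Lemma extend0_volume_le i : (mi i <= ma i)%N.
Proof. by rewrite /mi /ma /extend0; case: insub => // j; apply: volume_le. Qed.

Lemma ratr_div_nat (q a : nat) : ratr (a%:R / q%:R) = a%:R / q%:R :> R.
Proof. by rewrite fmorph_div /= !ratr_nat. Qed.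

Lemma ratr_amount_cost (q a : nat) (i : 'I_n) : (0 < q)%N ->
  ratr (amount_cost la c al be q i a) =
    delivery_cost i (ratr (a%:R / q%:R) : R)
    + (c%:R * ratr (a%:R / q%:R) ^+ 2) / (2 * la%:R).
Proof.
move=> q_gt0; have q0 : q%:R != 0 :> R by rewrite pnatr_eq0 -lt0n.
rewrite /amount_cost /delivery_cost ratr_div_nat.
have [-> | a_neq0] := eqVneq a 0%N.
  by rewrite !mul0r eqxx expr0n mulr0 mul0r addr0 rmorph0.
rewrite mulf_eq0 invr_eq0 (negbTE q0) pnatr_eq0 (negbTE a_neq0) /= /active_cost.
rewrite /al /be !extend0_ord !(rmorphD, rmorphM, fmorphV) /=.
by rewrite !ratr_nat rmorph1.
Qed.

Lemma total_cost_grid (q : nat) (a : nat -> nat) : (0 < q)%N ->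
  total_cost (fun i : 'I_n => ratr ((a i)%:R / q%:R) : R)
    = ratr (\sum_(i < n) amount_cost la c al be q i (a i)).
Proof.
move=> q_gt0; rewrite rmorph_sum /= /total_cost -big_split /=.
by apply: eq_bigr => i _; rewrite ratr_amount_cost.
Qed.

(** No feasible vector is cheaper than the best solution found on the grids. *)
Lemma best_solution_lower_bound (y : 'I_n -> R) :
  feasible y -> ratr best.1 <= total_cost y.
Proof.
move=> [sum_y box_y].
(* Inactive suppliers get the bounds [0] and [0]. *)
pose lo i := if y i == 0 then 0%N else min_volume i.
pose hi i := if y i == 0 then 0%N else max_volume i.
have le_lohi i : (lo i <= hi i)%N.
  by rewrite /lo /hi; case: ifP => // _; apply: volume_le.
have box : in_box lo hi y.
  move=> i; rewrite /lo /hi; case: eqP => [-> | y0]; first by rewrite lexx.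
  by case: (box_y i).
have [k [a [/andP[k_gt0 le_k] grid_a sum_a cost_a]]] :=
  round_to_grid (@unit_cost I) (suppliers_gt0 I) (intensity_gt0 I)
    (storage_cost_gt0 I) le_lohi box sum_y.
case: k k_gt0 le_k grid_a sum_a cost_a => // k _ lt_k grid_a sum_a cost_a.
set q := (c * k.+1)%N in grid_a sum_a cost_a.
have q_gt0 : (0 < q)%N by rewrite muln_gt0 storage_cost_gt0.
have rq_gt0 : (0 : R) < q%:R by rewrite ltr0n.
pose x := extend0 a.
have x_ok l : (l < n)%N -> allowed mi ma q l (x l).
  move=> lt_l; have := grid_a (Ordinal lt_l); rewrite /lo /hi.
  rewrite /x /mi /ma -[l]/(val (Ordinal lt_l)) !extend0_ord.
  case: eqP => _; first by rewrite !muln0 leqn0 => /andP[_ /eqP ->]; left.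
  by move=> le_a; right; rewrite !extend0_ord.
have le_best : best.1 <= \sum_(l < n) amount_cost la c al be q l (x l).
  apply: le_trans (best_solution_le n P la c al be mi ma lt_k) _.
  apply: le_trans (best_cost_le n la c al be (P * q) x_ok) _.
  rewrite /penalized_cost (eq_bigr a) => [|i _]; last by rewrite /x extend0_ord.
  by rewrite sum_a addr0.
apply: le_trans (_ : ratr (\sum_(l < n) amount_cost la c al be q l (x l)) <= _).
  by rewrite ler_rat.
pose al' i : R := if y i == 0 then 0 else (fixed_cost i)%:R.
apply: le_trans (_ : \sum_i al' i
    + convex_cost la c (@unit_cost I) (fun i => (a i)%:R / q%:R) <= _).
  rewrite rmorph_sum /= /convex_cost -big_split; apply: ler_sum => i _ /=.
  rewrite ratr_amount_cost // ratr_div_nat addrA /x extend0_ord lerD2r.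
  rewrite /delivery_cost /al'; have := grid_a i; rewrite /lo /hi.
  have [_ | _ _] := eqVneq (y i) 0.
    rewrite !muln0 leqn0 => /andP[_ /eqP ->].
    by rewrite !mul0r eqxx mulr0 addr0.
  case: ifP => // _; by rewrite addr_ge0 ?mulr_ge0 ?invr_ge0 ?ler0n.
apply: le_trans (_ : \sum_i al' i + convex_cost la c (@unit_cost I) y <= _).
  by rewrite lerD2l.
rewrite /convex_cost /total_cost -!big_split; apply: ler_sum => i _ /=.
rewrite addrA lerD2r /al' /delivery_cost.
by case: eqP => // ->; rewrite mulr0 addr0.
Qed.

Lemma best_solution_lt_penalty (y : 'I_n -> R) : feasible y -> best.1 < pen.
Proof.
move=> [sum_y box_y].
have le_P : (P <= \sum_(i < n) max_volume i)%N.
  rewrite -(ler_nat R) natr_sum; apply: le_trans sum_y _; apply: ler_sum => i _.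
  by case: (box_y i) => [-> | /andP[]].
have c_gt0 := storage_cost_gt0 I.
(* All maximal volumes, on the grid of step [1 / c]. *)
pose x l := (c * ma l)%N.
have x_ok l : (l < n)%N -> allowed mi ma (c * 1) l (x l).
  by move=> _; right; rewrite muln1 leqnn leq_mul2l extend0_volume_le orbT.
apply: le_lt_trans (best_solution_le n P la c al be mi ma (suppliers_gt0 I)) _.
apply: le_lt_trans (best_cost_le n la c al be _ x_ok) _.
rewrite /penalized_cost -big_distrr /= [(P * _)%N]mulnC muln1 leq_mul2l.
rewrite [X in (P <= X)%N](eq_bigr (@max_volume I)) => [|i _]; last first.
  by rewrite /ma extend0_ord.
rewrite le_P orbT addr0 /penalty.
apply: le_lt_trans (_ : \sum_(i < n) active_cost la c al be i (ma i)%:R < _); last first.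
  by rewrite ltrDr ltr01.
apply: ler_sum => i _; apply: le_trans (amount_cost_le _ _ _ _ _ _ _) _.
rewrite /x natrM mulrAC mulfV ?mul1r //.
by rewrite pnatr_eq0 -lt0n.
Qed.

Lemma best_solution_optimal (x : 'I_n -> R) :
  (forall i : 'I_n, x i = ratr (best.2 i)) -> best.1 < pen ->
  optimal x /\ ratr best.1 = total_cost x.
Proof.
move=> xE lt_best.
have [k lt_k [best1 best2]] := best_solution_attained lt_best.
set q := (c * k.+1)%N in best1 best2.
have q_gt0 : (0 < q)%N by rewrite muln_gt0 storage_cost_gt0.
set a := best_plan n la c al be mi ma q n (P * q) in best2.
have := penalized_cost_plan n la c al be extend0_volume_le q n (P * q).
rewrite -/a -best1 /penalized_cost.
case: ifP => [sum_a | _ le_pen]; last first.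
  have := lt_best; rewrite ltNge => /negP[]; apply: le_trans le_pen.
  by rewrite lerDr sumr_ge0 // => i _; apply: amount_cost_ge0.
rewrite addr0 => cost_a.
have rq0 : q%:R != 0 :> R by rewrite pnatr_eq0 -lt0n.
have xE' i : x i = (a i)%:R / q%:R by rewrite xE best2 ratr_div_nat.
have cost_x : total_cost x = ratr (\sum_(i < n) amount_cost la c al be q i (a i)).
  rewrite -total_cost_grid // /total_cost.
  by congr (_ + _); apply: eq_bigr => i _; rewrite xE best2.
have feas_x : feasible x.
  have rq_gt0 : (0 : R) < q%:R by rewrite ltr0n.
  split.
    rewrite (eq_bigr _ (fun i _ => xE' i)) -mulr_suml ler_pdivlMr //.
    by rewrite -natrM -natr_sum ler_nat.
  move=> i; rewrite xE'.
  have := best_plan_allowed n la c al be extend0_volume_le q (P * q) (ltn_ord i).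
  rewrite -/a => -[-> | ]; first by left; rewrite mul0r.
  rewrite /mi /ma !extend0_ord => le_a; right.
  by rewrite ler_pdivlMr // ler_pdivrMr // -!natrM !ler_nat ![(_ * q)%N]mulnC.
have best_x : ratr best.1 = total_cost x.
  by apply/le_anti; rewrite best_solution_lower_bound // cost_x ler_rat cost_a.
split=> //; split=> // y feas_y; rewrite -best_x.
exact: best_solution_lower_bound.
Qed.

Lemma solver_input : exists t s,
  [/\ exec solver (input I) t s,
     (t <= 4000 * (P * n ^ 3 * c ^ 2 * total_range I))%N & correct_output R I s].
Proof.
have inp : has_input n P la c al be mi ma (input I).
  split; first by split.
  by split=> i; rewrite /= /ord_fun /al /be /mi /ma /extend0; case: insub.
have [t [s [ex le_t [s0 s1 sol]]]] := solver_runs (suppliers_gt0 I)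
  (demand_gt0 I) (intensity_gt0 I) (storage_cost_gt0 I) extend0_volume_le inp.
exists t, s; split=> //.
  apply: leq_trans le_t _.
  apply: leq_trans (solver_time_le mi ma (suppliers_gt0 I) (demand_gt0 I)
    (intensity_gt0 I) (storage_cost_gt0 I)) _.
  rewrite /total_range (eq_bigr (fun i => max_volume i - min_volume i)%N) // => i _.
  by rewrite /mi /ma !extend0_ord.
split=> [[y feas_y] | infeas].
  have lt_best := best_solution_lt_penalty feas_y.
  have [|opt cost] := @best_solution_optimal (fun i => ratr (arr s 0%N i)) _ lt_best.
    by move=> i; rewrite sol.
  by split=> //; [rewrite s0 lt_best | rewrite s1].
rewrite s0; case: (boolP (_ < _)) => // lt_best; case: infeas.
have [[feas _] _] := best_solution_optimal (fun=> erefl) lt_best.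
by exists (fun i => ratr (best.2 i)).
Qed.

Lemma solver_bound_polynomial :
  (P * n ^ 3 * c ^ 2 * total_range I
     <= (number_of_parameters I + sum_of_parameters I) ^ 7)%N.
Proof.
set N := (_ + _)%N.
have le_P : (P <= N)%N by rewrite /N /sum_of_parameters; lia.
have le_n : (n <= N)%N by rewrite /N /sum_of_parameters; lia.
have le_c : (c <= N)%N by rewrite /N /sum_of_parameters; lia.
have le_r : (total_range I <= N)%N.
  rewrite geq_max; apply/andP; split; first by rewrite /N /number_of_parameters; lia.
  apply: leq_trans (_ : \sum_(i < n) (fixed_cost i + unit_cost i + min_volume i
      + max_volume i) <= _)%N.
    by apply: leq_sum => i _; lia.
  by rewrite /N /sum_of_parameters; lia.
have -> : (N ^ 7 = N * N ^ 3 * N ^ 2 * N)%N by ring.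
by rewrite !leq_mul ?leq_exp2r.
Qed.

End Optimality.

Theorem mainTheorem2 (R : realType) :
  exists A : program,
    [/\ solves R A,
        pseudopolynomial A &
        ops_bigO A (fun I =>
          demand I * suppliers I ^ 3 * storage_cost I ^ 2 * total_range I)%N].
Proof.
have time I t s : exec solver (input I) t s -> (t <= 4000 *
    (demand I * suppliers I ^ 3 * storage_cost I ^ 2 * total_range I))%N.
  move=> ex; have [t' [s' [ex' le_t' _]]] := solver_input R I.
  by have [-> _] := exec_deterministic ex ex'.
exists solver; split.
- by move=> I; have [t [s [ex _ out]]] := solver_input R I; exists t, s.
- exists 7%N, 4000%N => I t s /time le_t; apply: leq_trans le_t _.
  by rewrite leq_mul2l solver_bound_polynomial.
- by exists 4000%N.
Qed.
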